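(* Let $d,u\in\mathbb{N}_0$ with $d\ge u$, let $c_1,\ldots,c_d\in\mathbb{N}\setminus\{2\}$ with $c_1\ge3$ if $u\ge1$, and let $z_0,\ldots,z_d\in\mathbb{C}$ with $|z_j|<1$. With $c_0=1$, $c_{d+1}=0$, $\delta_i=\delta(c_i)+\delta(c_{i+1})$, $k_{-1}=0$, $$\sum_{\substack{a_0,\ldots,a_d\geq0\\ a_u\geq1}}t^{\star}(\{2\}^{a_0},c_1,\{2\}^{a_1},\ldots,c_d,\{2\}^{a_d})z_0^{2a_0}\cdots z_d^{2a_d}=z_u^2\cdot\frac{2}{\pi}\sum_{k_0\geq\cdots\geq k_d\geq1}\frac{1}{(2k_u-1)^2}\prod_{i=0}^{d}\frac{(-1)^{k_i\delta_i}(2k_i-1)^{\delta_i-1}}{(2k_i-1)^2-z_i^2}V_{k_{i-1},k_i}^{\#}(\{1\}^{c_i-3}).$$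
   Context: For an index $\boldsymbol{s}=(s_1,\ldots,s_r)$ of positive integers with $s_1>1$ (or empty), $t^{\star}(\boldsymbol{s})=\sum_{k_1\geq\cdots\geq k_r\geq1}\prod_{j=1}^r(2k_j-1)^{-s_j}$, $t^\star(\emptyset)=1$. $\{s\}^a$ denotes $s$ repeated $a$ times; for $a\le0$, $\{1\}^a$ is empty. $\triangle(k,m)=0$ if $k=m$, $1$ otherwise. For an index $\boldsymbol{s}=(s_1,\ldots,s_r)$ and $k,m\in\mathbb{N}_0$: if $\boldsymbol{s}\ne\emptyset$ and $k\ge m$, $V^{\#}_{k,m}(\boldsymbol{s})=\frac{2k-1}{2m-1}\sum_{k\geq l_1\geq\cdots\geq l_r\geq m}\frac{2^{\triangle(k,l_1)+\triangle(l_1,l_2)+\cdots+\triangle(l_r,m)}}{(2l_1-1)^{s_1}\cdots(2l_r-1)^{s_r}}$; otherwise $V^{\#}_{k,m}(\boldsymbol{s})=\left(2\cdot\frac{2k-1}{2m-1}\right)^{\triangle(k,m)}$. $\delta(0)=2$, $\delta(1)=1$, $\delta(c)=0$ for $c\ge3$. *)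

(* Defs.v *)
From Stdlib Require Import Reals List Arith.
From Coquelicot Require Import Coquelicot.
Open Scope R_scope.

(** odd number 2k-1 as a real (k may be 0, giving -1) *)
Definition odd_r (k : nat) : R := 2 * INR k - 1.

Definition tri (k m : nat) : nat := if Nat.eqb k m then 0%nat else 1%nat.

(** delta(0)=2, delta(1)=1, delta(c)=0 for c>=3 (delta(2) never used) *)
Definition delta (c : nat) : nat :=
  match c with 0 => 2 | 1 => 1 | _ => 0 end%nat.

Fixpoint tstar_trunc (s : list nat) (N : nat) : R :=
  match s with
  | nil => 1
  | s1 :: s' => sum_n_m (fun k => / (odd_r k) ^ s1 * tstar_trunc s' k) 1 N
  end.

(** t^star(s) as the limit of the (nondecreasing) truncations; t^star(nil) = 1 *)
Definition tstar (s : list nat) : R := real (Lim_seq (tstar_trunc s)).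

Fixpoint Wsum (s : list nat) (k m : nat) : R :=
  match s with
  | nil => 2 ^ (tri k m)
  | s1 :: s' => sum_n_m (fun l => 2 ^ (tri k l) * / (odd_r l) ^ s1 * Wsum s' l m) m k
  end.

Definition Vsharp (s : list nat) (k m : nat) : R :=
  match s with
  | nil => (2 * (odd_r k / odd_r m)) ^ (tri k m)
  | _ :: _ => if Nat.leb m k then odd_r k / odd_r m * Wsum s k m
              else (2 * (odd_r k / odd_r m)) ^ (tri k m)
  end.

(** {1}^a for a <= 0 is empty: here a = c - 3 with truncated subtraction *)
Definition ones (c : nat) : list nat := repeat 1%nat (c - 3).

Definition cext (d : nat) (c : nat -> nat) (i : nat) : nat :=
  if Nat.eqb i 0 then 1%nat else if Nat.eqb i (S d) then 0%nat else c i.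

Definition lhs_index (d : nat) (c : nat -> nat) (a : list nat) : list nat :=
  repeat 2%nat (nth 0 a 0%nat) ++
  flat_map (fun i => c i :: repeat 2%nat (nth i a 0%nat)) (seq 1 d).

Fixpoint boxsum (n N : nat) (F : list nat -> C) : C :=
  match n with
  | O => F nil
  | S n' => sum_n_m (fun a => boxsum n' N (fun l => F (a :: l))) 0 N
  end.

Fixpoint chainsum (n N : nat) (F : list nat -> C) : C :=
  match n with
  | O => F nil
  | S n' => sum_n_m (fun k => chainsum n' k (fun l => F (k :: l))) 1 N
  end.

Definition Cprod (l : list C) : C := fold_right Cmult (RtoC 1) l.

Definition lhs_trunc (d u : nat) (c : nat -> nat) (z : nat -> C) (N : nat) : C :=
  boxsum (S d) N (fun a =>
    if Nat.eqb (nth u a 0%nat) 0 then RtoC 0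
    else Cmult (RtoC (tstar (lhs_index d c a)))
         (Cprod (map (fun i => pow_n (z i) (2 * nth i a 0%nat)) (seq 0 (S d))))).

Definition rhs_factor (d : nat) (c : nat -> nat) (z : nat -> C) (ks : list nat) (i : nat) : C :=
  let ki := nth i ks 0%nat in
  let kprev := match i with O => 0%nat | S j => nth j ks 0%nat end in
  let di := (delta (cext d c i) + delta (cext d c (S i)))%nat in
  Cdiv (RtoC ((-1) ^ (ki * di) * powerRZ (odd_r ki) (Z.of_nat di - 1)
              * Vsharp (ones (cext d c i)) kprev ki))
       (Cminus (RtoC ((odd_r ki) ^ 2)) (Cmult (z i) (z i))).

Definition rhs_trunc (d u : nat) (c : nat -> nat) (z : nat -> C) (N : nat) : C :=
  Cmult (Cmult (Cmult (z u) (z u)) (RtoC (2 / PI)))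
  (chainsum (S d) N (fun ks =>
    Cmult (RtoC (/ (odd_r (nth u ks 0%nat)) ^ 2))
    (Cprod (map (rhs_factor d c z ks) (seq 0 (S d)))))).

(* Main.v *)
Require Import Defs.
From Stdlib Require Import Reals List Arith Lra Lia.
From Coquelicot Require Import Coquelicot.
Open Scope R_scope.

(** Let [L_c f n = sum_(m <= n) f m / (2m-1)^c], so that a truncated t-star sum is a product of
    operators [L_c] applied to the constant 1. The operator [L_2] is triangular with distinct
    eigenvalues [1/(2k-1)^2]; let [B] be its matrix of eigenvectors, normalised so that [B 1 = 1].
    In the basis [B], summing over a block [{2}^a] is a diagonal geometric series, producing the
    factors [(2k-1)^2 / ((2k-1)^2 - z^2)]. Since [L_c = L_2 D^(2-c)] with [D = diag (2k-1)], the other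
    [L_c] become [D^-2 K^(c-2)] with [K = B^-1 D^-1 B], and [K] has the entries
    [2^tri(k,m) (2k-1) / (2m-1)^2]: its positive powers are the [V#] of the statement and its inverse
    carries the signs of the case [c = 1]. This gives an exact identity for every truncation [n],
    with coefficients [B n k]. Finally [B n k] tends to [(4/pi) (-1)^(k-1) / (2k-1)], and two uses
    of Tannery's theorem let [n] and then the truncation of the exponents [a_i] go to infinity. *)

(** * Finite sums *)

(* Coquelicot's lemmas on [sum_n_m], restated with the operations of [R] and [C] so that [ring]
   and [lra] apply to the result. *)

Lemma Rsum_n_Sm (a : nat -> R) (n m : nat) : (n <= S m)%nat ->
  sum_n_m a n (S m) = sum_n_m a n m + a (S m).
Proof. exact (sum_n_Sm a n m). Qed.

Lemma Rsum_n_m_empty (a : nat -> R) (n m : nat) : (m < n)%nat -> sum_n_m a n m = 0.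
Proof. exact (sum_n_m_zero a n m). Qed.

Lemma Rsum_n_m_ext_loc (a b : nat -> R) (n m : nat) :
  (forall k, (n <= k <= m)%nat -> a k = b k) -> sum_n_m a n m = sum_n_m b n m :> R.
Proof. exact (sum_n_m_ext_loc a b n m). Qed.

Lemma Rsum_n_m_plus (a b : nat -> R) (n m : nat) :
  sum_n_m (fun k => a k + b k) n m = sum_n_m a n m + sum_n_m b n m.
Proof. exact (sum_n_m_plus a b n m). Qed.

Lemma Rsum_n_m_mult_l (x : R) (a : nat -> R) (n m : nat) :
  sum_n_m (fun k => x * a k) n m = x * sum_n_m a n m.
Proof. exact (sum_n_m_mult_l (K := R_Ring) x a n m). Qed.

Lemma Rsum_n_m_mult_r (x : R) (a : nat -> R) (n m : nat) :
  sum_n_m (fun k => a k * x) n m = sum_n_m a n m * x.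
Proof. exact (sum_n_m_mult_r (K := R_Ring) x a n m). Qed.

Lemma Csum_n_m_ext_loc (a b : nat -> C) (n m : nat) :
  (forall k, (n <= k <= m)%nat -> a k = b k) -> sum_n_m a n m = sum_n_m b n m :> C.
Proof. exact (sum_n_m_ext_loc a b n m). Qed.

Lemma Csum_n_m_mult_l (x : C) (a : nat -> C) (n m : nat) :
  sum_n_m (fun k => (x * a k)%C) n m = (x * sum_n_m a n m)%C.
Proof. exact (sum_n_m_mult_l (K := C_Ring) x a n m). Qed.

Lemma Csum_n_m_mult_r (x : C) (a : nat -> C) (n m : nat) :
  sum_n_m (fun k => (a k * x)%C) n m = (sum_n_m a n m * x)%C.
Proof. exact (sum_n_m_mult_r (K := C_Ring) x a n m). Qed.

Lemma RtoC_sum_n_m (a : nat -> R) (n m : nat) :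
  RtoC (sum_n_m a n m) = sum_n_m (fun k => RtoC (a k)) n m.
Proof.
  destruct (le_lt_dec n m) as [H|H].
  - induction H as [|m H IH]; [now rewrite !sum_n_n|].
    rewrite !sum_n_Sm, <- IH by lia. apply RtoC_plus.
  - now rewrite !sum_n_m_zero by exact H.
Qed.

Lemma sum_n_m_le_loc (a b : nat -> R) (n m : nat) :
  (forall k, (n <= k <= m)%nat -> a k <= b k) -> sum_n_m a n m <= sum_n_m b n m.
Proof.
  intros H. destruct (le_lt_dec n m) as [Hnm|Hnm].
  - induction Hnm as [|m Hnm IH].
    + rewrite !sum_n_n. apply H. lia.
    + rewrite !Rsum_n_Sm by lia. apply Rplus_le_compat; [apply IH; intros|]; apply H; lia.
  - rewrite !Rsum_n_m_empty by exact Hnm. apply Rle_refl.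
Qed.

Lemma sum_n_m_nonneg (a : nat -> R) (n m : nat) :
  (forall k, (n <= k <= m)%nat -> 0 <= a k) -> 0 <= sum_n_m a n m.
Proof.
  intros H. replace 0 with (sum_n_m (fun _ => 0) n m)
    by apply (sum_n_m_const_zero (G := R_AbelianMonoid)).
  apply sum_n_m_le_loc. exact H.
Qed.

Lemma sum_n_m_trailing_zeros {G : AbelianMonoid} (a : nat -> G) (p n m : nat) :
  (p <= S n)%nat -> (n <= m)%nat -> (forall k, (n < k)%nat -> a k = zero) ->
  sum_n_m a p m = sum_n_m a p n.
Proof.
  intros Hp Hm Ha. rewrite (sum_n_m_Chasles a p n m) by assumption.
  rewrite (sum_n_m_ext_loc a (fun _ => zero) (S n) m) by (intros k Hk; apply Ha; lia).
  rewrite sum_n_m_const_zero. apply plus_zero_r.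
Qed.

Lemma sum_n_m_exchange {G : AbelianMonoid} (f : nat -> nat -> G) (a b p q : nat) :
  sum_n_m (fun i => sum_n_m (f i) p q) a b = sum_n_m (fun j => sum_n_m (fun i => f i j) a b) p q.
Proof.
  destruct (le_lt_dec a b) as [H|H].
  - induction H as [|b H IH].
    + rewrite sum_n_n. apply sum_n_m_ext. intros j. now rewrite sum_n_n.
    + rewrite sum_n_Sm, IH, <- sum_n_m_plus by lia.
      apply sum_n_m_ext. intros j. now rewrite sum_n_Sm by lia.
  - rewrite sum_n_m_zero by exact H. rewrite <- (sum_n_m_const_zero p q).
    apply sum_n_m_ext. intros j. now rewrite sum_n_m_zero.
Qed.

Lemma sum_n_m_triangle {G : AbelianMonoid} (f : nat -> nat -> G) (p n : nat) :
  sum_n_m (fun k => sum_n_m (f k) p k) p n =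
  sum_n_m (fun l => sum_n_m (fun k => f k l) l n) p n.
Proof.
  destruct (le_lt_dec p n) as [Hp|Hp]; [|now rewrite !sum_n_m_zero].
  induction Hp as [|n Hp IH]; [now rewrite !sum_n_n|].
  assert (HpS : (p <= S n)%nat) by lia.
  rewrite !sum_n_Sm by exact HpS. rewrite IH, sum_n_n, plus_assoc, <- sum_n_m_plus. f_equal.
  apply sum_n_m_ext_loc. intros k Hk. now rewrite sum_n_Sm by lia.
Qed.

(** * Limits and series *)

Lemma filterlim_sum_n_m {T : Type} {F : (T -> Prop) -> Prop} {FF : Filter F}
  {K : AbsRing} {V : NormedModule K} (f : T -> nat -> V) (g : nat -> V) (p q : nat) :
  (forall k, (p <= k <= q)%nat -> filterlim (fun x => f x k) F (locally (g k))) ->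
  filterlim (fun x => sum_n_m (f x) p q) F (locally (sum_n_m g p q)).
Proof.
  intros H. destruct (le_lt_dec p q) as [Hpq|Hpq].
  - induction Hpq as [|q Hpq IH].
    + rewrite sum_n_n. apply filterlim_ext with (fun x => f x p); [|apply H; lia].
      intros x. now rewrite sum_n_n.
    + rewrite sum_n_Sm by lia.
      apply filterlim_ext with (fun x => plus (sum_n_m (f x) p q) (f x (S q))).
      { intros x. now rewrite sum_n_Sm by lia. }
      apply (filterlim_comp_2 (G := locally (sum_n_m g p q)) (H := locally (g (S q))));
        [apply IH; intros; apply H; lia|apply H; lia|apply filterlim_plus].
  - rewrite sum_n_m_zero by exact Hpq.
    apply filterlim_ext with (fun _ => zero); [|apply filterlim_const].
    intros x. now rewrite sum_n_m_zero.
Qed.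

Lemma filterlim_Cmult {T : Type} {F : (T -> Prop) -> Prop} {FF : Filter F}
  (f g : T -> C) (x y : C) :
  filterlim f F (locally x) -> filterlim g F (locally y) ->
  filterlim (fun t => (f t * g t)%C) F (locally (x * y)%C).
Proof.
  intros Hf Hg.
  assert (Hf' : filterlim f F (@locally (AbsRing_UniformSpace C_AbsRing) x)).
  { intros P HP. apply Hf, locally_C, HP. }
  apply (filterlim_comp_2 (G := @locally (AbsRing_UniformSpace C_AbsRing) x) (H := locally y));
    [exact Hf'|exact Hg|exact (filterlim_scal (V := C_NormedModule) x y)].
Qed.

Lemma filterlim_RtoC_comp {T : Type} {F : (T -> Prop) -> Prop} {FF : Filter F} (f : T -> R) (x : R) :
  filterlim f F (locally x) -> filterlim (fun t => RtoC (f t)) F (locally (RtoC x)).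
Proof.
  intros Hf. apply filterlim_locally. intros eps.
  apply filter_imp with (2 := proj1 (filterlim_locally f x) Hf eps).
  intros t Ht. split; [exact Ht|apply ball_center].
Qed.

Lemma filterlim_Cpow_zero (q : C) : Cmod q < 1 ->
  filterlim (fun n => (q ^ n)%C) eventually (locally (RtoC 0)).
Proof.
  intros Hq. apply (filterlim_norm_zero (V := C_NormedModule)).
  apply filterlim_ext with (fun n => Cmod q ^ n).
  { intros n. symmetry. apply Cmod_pow. }
  apply (is_lim_seq_geom (Cmod q)). rewrite Rabs_pos_eq by apply Cmod_ge_0. exact Hq.
Qed.

Lemma is_series_shift {K : AbsRing} {V : NormedModule K} (a : nat -> V) (l : V) :
  is_series (fun k => a (S k)) l -> filterlim (sum_n_m a 1) eventually (locally l).
Proof.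
  intros H P HP. destruct (H P HP) as [N HN]. exists (S N). intros [|n] Hn; [lia|].
  rewrite <- sum_n_m_S. apply HN. lia.
Qed.

Lemma is_series_trailing_zeros {K : AbsRing} {V : NormedModule K} (a : nat -> V) (n : nat) :
  (forall k, (n < k)%nat -> a k = zero) -> is_series (fun k => a (S k)) (sum_n_m a 1 n).
Proof.
  intros Ha. apply filterlim_ext_loc with (fun _ => sum_n_m a 1 n); [|apply filterlim_const].
  exists n. intros p Hp. unfold sum_n. rewrite sum_n_m_S.
  symmetry. apply sum_n_m_trailing_zeros; [lia|lia|exact Ha].
Qed.

Lemma filterlim_sum_n_uniform {T : Type} {K : AbsRing} {V : NormedModule K}
  (f : T -> nat -> V) (s : T -> V) (w : nat -> R) :
  (forall x k, norm (f x k) <= w k) -> ex_series w -> (forall x, is_series (f x) (s x)) ->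
  filterlim (fun p x => sum_n (f x) p) eventually (@locally (fct_UniformSpace T V) s).
Proof.
  intros Hf Hw Hs. apply (filterlim_locally (U := fct_UniformSpace T V)). intros eps.
  destruct (Cauchy_ex_series w Hw (pos_div_2 eps)) as [N HN].
  exists N. intros p Hp x.
  destruct (proj1 (filterlim_locally _ _) (Hs x) (pos_div_2 eps)) as [M HM].
  set (q := S (p + M)).
  replace (pos eps) with (pos_div_2 eps + pos_div_2 eps) by (simpl; field).
  apply ball_triangle with (sum_n (f x) q); [apply HM; lia|].
  apply ball_sym, norm_compat1.
  replace (minus _ _) with (sum_n_m (f x) (S p) q)
    by (apply (sum_n_m_sum_n (G := NormedModule.AbelianGroup K V)); lia).
  apply Rle_lt_trans with (1 := norm_sum_n_m _ _ _).
  apply Rle_lt_trans with (sum_n_m w (S p) q); [apply sum_n_m_le, Hf|].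
  apply Rle_lt_trans with (1 := Rle_abs _). apply HN; lia.
Qed.

(* Tannery's theorem: Moore and Osgood's exchange of limits, with uniformity from the M-test. *)
Lemma is_series_dominated {T : Type} {F : (T -> Prop) -> Prop} {FF : ProperFilter F}
  {K : AbsRing} {V : CompleteNormedModule K}
  (f : T -> nat -> V) (g : nat -> V) (s : T -> V) (w : nat -> R) :
  (forall x k, norm (f x k) <= w k) -> ex_series w ->
  (forall k, filterlim (fun x => f x k) F (locally (g k))) ->
  (forall x, is_series (f x) (s x)) ->
  exists l : V, is_series g l /\ filterlim s F (locally l).
Proof.
  intros Hf Hw Hg Hs.
  apply (filterlim_switch eventually _ F _ (fun p x => sum_n (f x) p)).
  - exact (filterlim_sum_n_uniform f s w Hf Hw Hs).
  - intros p. exact (filterlim_sum_n_m (V := V) f g 0 p (fun k _ => Hg k)).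
Qed.

(** * Odd numbers *)

Lemma one_le_INR (k : nat) : (1 <= k)%nat -> 1 <= INR k.
Proof. exact (le_INR 1 k). Qed.

Lemma INR_le_odd_r (k : nat) : (1 <= k)%nat -> INR k <= odd_r k.
Proof. intros Hk. apply one_le_INR in Hk. unfold odd_r. lra. Qed.

Lemma odd_r_ge1 (k : nat) : (1 <= k)%nat -> 1 <= odd_r k.
Proof. intros Hk. apply one_le_INR in Hk. unfold odd_r. lra. Qed.

Lemma odd_r_neq0 (k : nat) : odd_r k <> 0.
Proof.
  destruct k as [|k]; [unfold odd_r; simpl; lra|].
  pose proof (odd_r_ge1 (S k) ltac:(lia)). lra.
Qed.

Lemma odd_r_pow_neq0 (k e : nat) : odd_r k ^ e <> 0.
Proof. apply pow_nonzero, odd_r_neq0. Qed.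

Lemma odd_r_S (k : nat) : odd_r (S k) = odd_r k + 2.
Proof. unfold odd_r. rewrite S_INR. ring. Qed.

Lemma inv_odd_r_nonneg (k : nat) : (1 <= k)%nat -> 0 <= / odd_r k.
Proof. intros Hk. pose proof (odd_r_ge1 k Hk). apply Rlt_le, Rinv_0_lt_compat. lra. Qed.

Lemma inv_odd_r_le_inv_INR (k : nat) : (1 <= k)%nat -> / odd_r k <= / INR k.
Proof.
  intros Hk. pose proof (one_le_INR k Hk). apply Rinv_le_contravar; [lra|apply INR_le_odd_r, Hk].
Qed.

Lemma inv_odd_r_pow_le (k a b : nat) : (1 <= k)%nat -> (a <= b)%nat -> / odd_r k ^ b <= / odd_r k ^ a.
Proof.
  intros Hk Hab. pose proof (odd_r_ge1 k Hk). apply Rinv_le_contravar.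
  - apply pow_lt. lra.
  - apply Rle_pow; assumption.
Qed.

Lemma inv_odd_r_pow_nonneg (k a : nat) : (1 <= k)%nat -> 0 <= / odd_r k ^ a.
Proof. intros Hk. rewrite <- pow_inv. apply pow_le, inv_odd_r_nonneg, Hk. Qed.

(** * The eigenvectors of the summation operator with weight [1/(2k-1)^2] *)

(* The value 0 at [n = 0] makes the recursion in [eigvec_num_S_l] start at [n = 0]. *)
Fixpoint wallis (n : nat) : R :=
  match n with
  | O => 0
  | S O => 1
  | S m => wallis m * (odd_r n ^ 2 / (odd_r n ^ 2 - 1))
  end.

Fixpoint eigvec_num (n k : nat) : R :=
  match k with
  | O => wallis n
  | S k' => eigvec_num n k' * ((INR n - INR k') / (INR n + INR k'))
  end.

(* Column k is the eigenvector of f |-> (n |-> sum_(m <= n) f m / (2m-1)^2) with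
   eigenvalue (2k-1)^-2, normalised so that the rows sum to 1. In closed form
   eigvec_num n k = 4 ((2n-1)!!)^2 / (4^n (n-k)! (n+k-1)!). *)
Definition eigvec (n k : nat) : R := (-1) ^ S k * eigvec_num n k / odd_r k.

Lemma wallis_S (n : nat) : (1 <= n)%nat ->
  wallis (S n) = wallis n * (odd_r (S n) ^ 2 / (odd_r (S n) ^ 2 - 1)).
Proof. destruct n; [lia|reflexivity]. Qed.

Lemma odd_r_sqr_gt1 (n : nat) : (1 <= n)%nat -> 1 < odd_r (S n) ^ 2.
Proof. intros Hn. pose proof (odd_r_ge1 n Hn). rewrite odd_r_S. nra. Qed.

Lemma eigvec_num_O_l (k : nat) : eigvec_num 0 k = 0.
Proof. induction k as [|k IH]; simpl; [reflexivity|]. rewrite IH. ring. Qed.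

Lemma eigvec_num_S_r (n k : nat) :
  (INR n + INR k) * eigvec_num n (S k) = (INR n - INR k) * eigvec_num n k.
Proof.
  destruct n as [|n]; [rewrite !eigvec_num_O_l; ring|].
  cbn [eigvec_num]. field. rewrite S_INR. pose proof (pos_INR n). pose proof (pos_INR k). lra.
Qed.

Lemma eigvec_num_1 (n : nat) : eigvec_num n 1 = wallis n.
Proof.
  destruct n as [|n]; [apply eigvec_num_O_l|].
  cbn [eigvec_num]. change (INR 0) with 0. field. apply not_0_INR. lia.
Qed.

Lemma eigvec_num_gt (n k : nat) : (n < k)%nat -> eigvec_num n k = 0.
Proof.
  induction 1 as [|k H IH]; simpl.
  - rewrite Rminus_diag. unfold Rdiv. ring.
  - rewrite IH. ring.
Qed.

Lemma eigvec_gt (n k : nat) : (n < k)%nat -> eigvec n k = 0.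
Proof. intros H. unfold eigvec. rewrite eigvec_num_gt by exact H. unfold Rdiv. ring. Qed.

Lemma eigvec_num_S_l (n k : nat) : (1 <= k)%nat ->
  eigvec_num n k * odd_r (S n) ^ 2 = eigvec_num (S n) k * (odd_r (S n) ^ 2 - odd_r k ^ 2).
Proof.
  induction 1 as [|k Hk IH].
  - rewrite !eigvec_num_1. replace (odd_r 1 ^ 2) with 1 by (unfold odd_r; simpl; ring).
    destruct n as [|n]; [unfold odd_r; simpl; ring|].
    rewrite (wallis_S (S n)) by lia. pose proof (odd_r_sqr_gt1 (S n) ltac:(lia)). field. lra.
  - cbn [eigvec_num].
    transitivity (eigvec_num n k * odd_r (S n) ^ 2 * ((INR n - INR k) / (INR n + INR k))); [ring|].
    rewrite IH. unfold odd_r. rewrite !S_INR.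
    pose proof (one_le_INR k Hk). pose proof (pos_INR n). field. lra.
Qed.

(* The eigenvector equation, differenced in [n]. *)
Lemma eigvec_S_l (n k : nat) : (1 <= k)%nat ->
  / odd_r (S n) ^ 2 * eigvec (S n) k = (eigvec (S n) k - eigvec n k) * / odd_r k ^ 2.
Proof.
  intros Hk. pose proof (eigvec_num_S_l n k Hk) as H.
  pose proof (odd_r_neq0 k). pose proof (odd_r_neq0 (S n)).
  assert (E : eigvec_num n k = eigvec_num (S n) k * (odd_r (S n) ^ 2 - odd_r k ^ 2) / odd_r (S n) ^ 2).
  { rewrite <- H. field. assumption. }
  unfold eigvec. rewrite E. field. split; assumption.
Qed.

Lemma eigvec_S_r (n k : nat) :
  odd_r n * (eigvec n k * odd_r k + eigvec n (S k) * odd_r (S k)) =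
  eigvec n k * odd_r k ^ 2 - eigvec n (S k) * odd_r (S k) ^ 2.
Proof.
  pose proof (eigvec_num_S_r n k) as H.
  transitivity ((-1) ^ S k * (odd_r n * (eigvec_num n k - eigvec_num n (S k)))).
  { unfold eigvec. simpl pow. field. split; apply odd_r_neq0. }
  transitivity ((-1) ^ S k * (odd_r k * eigvec_num n k + odd_r (S k) * eigvec_num n (S k))).
  2:{ unfold eigvec. simpl pow. field. split; apply odd_r_neq0. }
  f_equal. unfold odd_r. rewrite S_INR. lra.
Qed.

Lemma sum_eigvec_odd_sqr (n m : nat) : (1 <= n)%nat ->
  (INR n - 1) * sum_n_m (fun k => eigvec n k * odd_r k ^ 2) 1 m =
  (-1) ^ S m * INR m * (INR n - INR m) * eigvec_num n m.
Proof.
  intros Hn. induction m as [|m IH].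
  - rewrite Rsum_n_m_empty by lia. simpl. ring.
  - rewrite Rsum_n_Sm, Rmult_plus_distr_l, IH by lia.
    transitivity ((-1) ^ S m * INR m * ((INR n + INR m) * eigvec_num n (S m)) +
      (INR n - 1) * ((-1) ^ S (S m) * eigvec_num n (S m) * odd_r (S m))).
    + rewrite eigvec_num_S_r. unfold eigvec. field. apply odd_r_neq0.
    + unfold odd_r. rewrite !S_INR. simpl pow. ring.
Qed.

Lemma sum_eigvec_stable (n m : nat) : (n <= m)%nat ->
  sum_n_m (eigvec n) 1 m = sum_n_m (eigvec n) 1 n :> R.
Proof.
  intros H. apply (sum_n_m_trailing_zeros (G := R_AbelianMonoid)); [lia|exact H|].
  intros k Hk. apply eigvec_gt, Hk.
Qed.

Lemma sum_eigvec (n m : nat) : (1 <= n <= m)%nat -> sum_n_m (eigvec n) 1 m = 1.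
Proof.
  intros [Hn Hm]. rewrite sum_eigvec_stable by exact Hm. clear m Hm.
  induction Hn as [|n Hn IH].
  { rewrite sum_n_n. unfold eigvec. rewrite eigvec_num_1. unfold odd_r. simpl. field. }
  assert (H : sum_n_m (fun k => eigvec (S n) k * odd_r k ^ 2) 1 (S n) = 0).
  { pose proof (sum_eigvec_odd_sqr (S n) (S n) ltac:(lia)) as H.
    rewrite Rminus_diag, Rmult_0_r, Rmult_0_l, S_INR in H.
    pose proof (one_le_INR n Hn). apply Rmult_integral in H. destruct H as [H|H]; lra. }
  assert (E : sum_n_m (fun k => eigvec (S n) k + -1 * eigvec n k) 1 (S n) = 0).
  { rewrite <- (Rmult_0_r (/ odd_r (S n) ^ 2)), <- H, <- Rsum_n_m_mult_l.
    apply Rsum_n_m_ext_loc. intros k [Hk _].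
    rewrite <- Rmult_assoc, eigvec_S_l by exact Hk. field. apply odd_r_neq0. }
  rewrite Rsum_n_m_plus, Rsum_n_m_mult_l, (sum_eigvec_stable n (S n)), IH in E by lia. lra.
Qed.

(** * Size and limit of the eigenvectors *)

Lemma wallis_nonneg (n : nat) : 0 <= wallis n.
Proof.
  induction n as [|[|n] IH]; [simpl; lra|simpl; lra|].
  rewrite wallis_S by lia. pose proof (odd_r_sqr_gt1 (S n) ltac:(lia)).
  apply Rmult_le_pos; [exact IH|]. apply Rdiv_le_0_compat; lra.
Qed.

Lemma wallis_incr (n : nat) : wallis n <= wallis (S n).
Proof.
  destruct n as [|n]; [simpl; lra|]. rewrite (wallis_S (S n)) by lia.
  pose proof (odd_r_sqr_gt1 (S n) ltac:(lia)).
  rewrite <- (Rmult_1_r (wallis (S n))) at 1.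
  apply Rmult_le_compat_l; [apply wallis_nonneg|]. apply Rle_div_r; lra.
Qed.

Lemma eigvec_num_nonneg (n k : nat) : 0 <= eigvec_num n k.
Proof.
  induction k as [|k IH]; [apply wallis_nonneg|].
  destruct (le_lt_dec (S k) n) as [H|H]; [|rewrite eigvec_num_gt by exact H; lra].
  apply le_INR in H. rewrite S_INR in H. pose proof (pos_INR k).
  apply Rmult_le_pos; [exact IH|]. apply Rdiv_le_0_compat; lra.
Qed.

Lemma eigvec_num_decr (n k : nat) : eigvec_num n (S k) <= eigvec_num n k.
Proof.
  destruct (le_lt_dec (S k) n) as [H|H].
  - pose proof (eigvec_num_S_r n k). pose proof (eigvec_num_nonneg n k).
    pose proof (eigvec_num_nonneg n (S k)). pose proof (pos_INR k).
    apply le_INR in H. rewrite S_INR in H. nra.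
  - rewrite eigvec_num_gt by exact H. apply eigvec_num_nonneg.
Qed.

Lemma eigvec_num_le_wallis (n k : nat) : eigvec_num n k <= wallis n.
Proof.
  induction k as [|k IH]; [apply Rle_refl|].
  apply Rle_trans with (1 := eigvec_num_decr n k), IH.
Qed.

(* [Rabs (eigvec n (S k))]: the index is shifted because [tg_alt] starts at 0. *)
Definition eigvec_abs (n k : nat) : R := eigvec_num n (S k) / odd_r (S k).

Lemma eigvec_abs_decreasing (n : nat) : Un_decreasing (eigvec_abs n).
Proof.
  intros k. unfold eigvec_abs, Rdiv. pose proof (odd_r_ge1 (S k) ltac:(lia)).
  apply Rmult_le_compat.
  - apply eigvec_num_nonneg.
  - apply inv_odd_r_nonneg. lia.
  - apply eigvec_num_decr.
  - rewrite (odd_r_S (S k)). apply Rinv_le_contravar; lra.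
Qed.

Lemma sum_eigvec_tg_alt (n m : nat) :
  sum_n_m (eigvec n) 1 (S m) = sum_f_R0 (tg_alt (eigvec_abs n)) m.
Proof.
  rewrite <- sum_n_m_S, <- sum_n_Reals. apply Rsum_n_m_ext_loc. intros k _.
  unfold tg_alt, eigvec_abs, eigvec. simpl pow. field. apply odd_r_neq0.
Qed.

Lemma sum_eigvec_alternates (n m : nat) : (1 <= n)%nat ->
  sum_f_R0 (tg_alt (eigvec_abs n)) (S (2 * m)) <= 1 <= sum_f_R0 (tg_alt (eigvec_abs n)) (2 * m).
Proof.
  intros Hn. apply alternated_series_ineq.
  - apply eigvec_abs_decreasing.
  - apply is_lim_seq_Reals, is_lim_seq_ext_loc with (fun _ => 0); [|apply is_lim_seq_const].
    exists n. intros k Hk. unfold eigvec_abs. rewrite eigvec_num_gt by lia. unfold Rdiv. ring.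
  - apply is_lim_seq_Reals, is_lim_seq_ext_loc with (fun _ => 1); [|apply is_lim_seq_const].
    exists n. intros k Hk. rewrite <- sum_eigvec_tg_alt. symmetry. apply sum_eigvec. lia.
Qed.

Lemma wallis_le_3_2 (n : nat) : wallis n <= 3 / 2.
Proof.
  destruct n as [|n]; [simpl; lra|].
  destruct (sum_eigvec_alternates (S n) 0 ltac:(lia)) as [H _].
  pose proof (eigvec_num_le_wallis (S n) 2).
  change (S (2 * 0)) with 1%nat in H. unfold tg_alt, eigvec_abs in H.
  cbn [sum_f_R0] in H. rewrite eigvec_num_1, pow_O, pow_1 in H.
  replace (odd_r 1) with 1 in H by (unfold odd_r; simpl; ring).
  replace (odd_r 2) with 3 in H by (unfold odd_r; simpl; ring). lra.
Qed.

Lemma Rabs_eigvec_le (n k : nat) : (1 <= k)%nat -> Rabs (eigvec n k) <= 2 / INR k.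
Proof.
  intros Hk. pose proof (odd_r_ge1 k Hk). pose proof (eigvec_num_nonneg n k).
  pose proof (eigvec_num_le_wallis n k). pose proof (wallis_le_3_2 n).
  unfold eigvec. rewrite Rabs_div, Rabs_mult, pow_1_abs, Rmult_1_l, !Rabs_pos_eq by lra.
  apply Rmult_le_compat; [lra|apply inv_odd_r_nonneg, Hk|lra|apply inv_odd_r_le_inv_INR, Hk].
Qed.

Lemma is_lim_seq_INR_ratio (k : nat) :
  is_lim_seq (fun n => (INR n - INR k) / (INR n + INR k)) 1.
Proof.
  apply is_lim_seq_ext_loc with (fun n => 1 - 2 * INR k * / (INR n + INR k)).
  { exists 1%nat. intros n Hn. pose proof (one_le_INR n Hn). pose proof (pos_INR k). field. lra. }
  replace (Finite 1) with (Finite (1 - 2 * INR k * 0)) by (f_equal; ring).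
  apply is_lim_seq_minus'; [apply is_lim_seq_const|].
  apply is_lim_seq_mult'; [apply is_lim_seq_const|].
  apply (is_lim_seq_inv _ p_infty); [|discriminate].
  eapply is_lim_seq_plus; [apply is_lim_seq_INR|apply is_lim_seq_const|]. reflexivity.
Qed.

Lemma is_lim_seq_eigvec_num (l : R) (k : nat) :
  is_lim_seq wallis l -> is_lim_seq (fun n => eigvec_num n k) l.
Proof.
  intros H. induction k as [|k IH]; [exact H|]. cbn [eigvec_num]. rewrite <- (Rmult_1_r l).
  apply is_lim_seq_mult'; [exact IH|apply is_lim_seq_INR_ratio].
Qed.

Lemma is_lim_seq_sum_eigvec_abs (l : R) (m : nat) : is_lim_seq wallis l ->
  is_lim_seq (fun n => sum_f_R0 (tg_alt (eigvec_abs n)) m) (l * sum_f_R0 (tg_alt PI_tg) m).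
Proof.
  intros H. rewrite <- sum_n_Reals, <- (sum_n_mult_l (K := R_Ring)).
  apply is_lim_seq_ext with (fun n => sum_n (tg_alt (eigvec_abs n)) m); [intros n; apply sum_n_Reals|].
  apply (filterlim_sum_n_m (V := R_NormedModule) (fun n => tg_alt (eigvec_abs n))). intros k _.
  replace (mult l (tg_alt PI_tg k)) with ((-1) ^ k * (l * / odd_r (S k))).
  - apply (is_lim_seq_mult' _ _ ((-1) ^ k)); [apply is_lim_seq_const|].
    apply is_lim_seq_mult'; [apply is_lim_seq_eigvec_num, H|apply is_lim_seq_const].
  - replace (odd_r (S k)) with (INR (2 * k + 1)).
    + change (mult l (tg_alt PI_tg k)) with (l * tg_alt PI_tg k). unfold tg_alt, PI_tg. ring.
    + unfold odd_r. rewrite S_INR, plus_INR, mult_INR. simpl INR. ring.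
Qed.

Lemma is_lim_seq_Leibniz : is_lim_seq (sum_f_R0 (tg_alt PI_tg)) (PI / 4).
Proof.
  apply is_lim_seq_Reals. rewrite <- Alt_PI_eq. unfold Alt_PI.
  destruct exist_PI as [a Ha]. replace (4 * a / 4) with a by field. exact Ha.
Qed.

(* The partial sums of every row of eigenvectors alternate around 1, and the rows converge to a
   multiple of the series 1 - 1/3 + 1/5 - ... *)
Lemma is_lim_seq_wallis : is_lim_seq wallis (4 / PI).
Proof.
  destruct (ex_finite_lim_seq_incr wallis (3 / 2) wallis_incr wallis_le_3_2) as [l Hl].
  assert (Hsub : forall phi, (forall m, (phi m < phi (S m))%nat) ->
    is_lim_seq (fun m => l * sum_f_R0 (tg_alt PI_tg) (phi m)) (l * (PI / 4))).
  { intros phi Hphi. apply is_lim_seq_mult'; [apply is_lim_seq_const|].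
    apply is_lim_seq_subseq; [apply eventually_subseq, Hphi|apply is_lim_seq_Leibniz]. }
  assert (Hle : l * (PI / 4) <= 1).
  { apply (is_lim_seq_le (fun m => l * sum_f_R0 (tg_alt PI_tg) (S (2 * m))) (fun _ => 1)
      (l * (PI / 4)) 1); [|apply Hsub; intros; lia|apply is_lim_seq_const].
    intros m.
    refine (is_lim_seq_le_loc _ _ _ 1 _ (is_lim_seq_sum_eigvec_abs l _ Hl) (is_lim_seq_const 1)).
    exists 1%nat. intros n Hn. now apply sum_eigvec_alternates. }
  assert (Hge : 1 <= l * (PI / 4)).
  { apply (is_lim_seq_le (fun _ => 1) (fun m => l * sum_f_R0 (tg_alt PI_tg) (2 * m))
      1 (l * (PI / 4))); [|apply is_lim_seq_const|apply Hsub; intros; lia].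
    intros m.
    refine (is_lim_seq_le_loc _ _ 1 _ _ (is_lim_seq_const 1) (is_lim_seq_sum_eigvec_abs l _ Hl)).
    exists 1%nat. intros n Hn. now apply sum_eigvec_alternates. }
  replace (4 / PI) with l; [exact Hl|].
  pose proof PI_RGT_0. apply Rmult_eq_reg_r with (PI / 4); [|lra].
  transitivity 1; [lra|field; lra].
Qed.

Definition eigvec_lim (k : nat) : R := 4 / PI * ((-1) ^ S k / odd_r k).

Lemma is_lim_seq_eigvec (k : nat) : is_lim_seq (fun n => eigvec n k) (eigvec_lim k).
Proof.
  apply is_lim_seq_ext with (fun n => eigvec_num n k * ((-1) ^ S k / odd_r k)).
  { intros n. unfold eigvec, Rdiv. ring. }
  apply is_lim_seq_mult'; [apply is_lim_seq_eigvec_num, is_lim_seq_wallis|apply is_lim_seq_const].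
Qed.

Lemma Rabs_eigvec_lim_le (k : nat) : (1 <= k)%nat -> Rabs (eigvec_lim k) <= 2 / INR k.
Proof.
  intros Hk.
  apply (is_lim_seq_le (fun n => Rabs (eigvec n k)) (fun _ => 2 / INR k)
    (Rabs (eigvec_lim k)) (2 / INR k)).
  - intros n. apply Rabs_eigvec_le, Hk.
  - apply (is_lim_seq_abs _ (eigvec_lim k)), is_lim_seq_eigvec.
  - apply is_lim_seq_const.
Qed.

(** * The summation operators in the basis of eigenvectors *)

Lemma tri_refl (k : nat) : tri k k = 0%nat.
Proof. unfold tri. now rewrite Nat.eqb_refl. Qed.

Lemma tri_neq (k m : nat) : k <> m -> tri k m = 1%nat.
Proof. intros H. apply Nat.eqb_neq in H. unfold tri. now rewrite H. Qed.

Lemma sum_pow_tri_telescope (f h : nat -> R) (m n : nat) : (m <= n)%nat ->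
  (forall k, (m <= k)%nat -> f k + f (S k) = h k - h (S k)) ->
  sum_n_m (fun k => f k * 2 ^ tri k m) m n = h m - h (S n) - f (S n) :> R.
Proof.
  intros Hmn Hfh. induction Hmn as [|n Hmn IH].
  - rewrite sum_n_n, tri_refl. specialize (Hfh m ltac:(lia)). simpl. lra.
  - rewrite Rsum_n_Sm, IH, tri_neq by lia. specialize (Hfh (S n) ltac:(lia)). simpl. lra.
Qed.

Lemma sum_eigvec_tri (n m : nat) :
  sum_n_m (fun k => eigvec n k * odd_r k * 2 ^ tri k m) m n =
  / odd_r n * eigvec n m * odd_r m ^ 2 :> R.
Proof.
  destruct (le_lt_dec m n) as [Hm|Hm].
  - rewrite (sum_pow_tri_telescope _ (fun k => / odd_r n * (eigvec n k * odd_r k ^ 2))).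
    + rewrite (eigvec_gt n (S n)) by lia. ring.
    + exact Hm.
    + intros k _. rewrite <- Rmult_minus_distr_l, <- eigvec_S_r. field. apply odd_r_neq0.
  - rewrite Rsum_n_m_empty, eigvec_gt by exact Hm. ring.
Qed.

Lemma sum_eigvec_alt_tri (n m : nat) :
  sum_n_m (fun k => eigvec n k * odd_r k ^ 2 * (-1) ^ (k + m) * 2 ^ tri k m) m n =
  odd_r n * eigvec n m * odd_r m :> R.
Proof.
  destruct (le_lt_dec m n) as [Hm|Hm].
  - rewrite (sum_pow_tri_telescope _ (fun k => (-1) ^ (k + m) * (odd_r n * eigvec n k * odd_r k))).
    + rewrite (eigvec_gt n (S n)) by lia. replace (m + m)%nat with (2 * m)%nat by lia.
      rewrite pow_1_even. ring.
    + exact Hm.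
    + intros k _.
      transitivity ((-1) ^ (k + m) * (eigvec n k * odd_r k ^ 2 - eigvec n (S k) * odd_r (S k) ^ 2)).
      * simpl pow. ring.
      * rewrite <- eigvec_S_r. simpl pow. ring.
  - rewrite Rsum_n_m_empty, eigvec_gt by exact Hm. ring.
Qed.

Lemma sum_eigvec_Wsum (e n m : nat) :
  sum_n_m (fun k => eigvec n k * odd_r k * Wsum (repeat 1%nat e) k m) m n =
  / odd_r n ^ S e * eigvec n m * odd_r m ^ 2 :> R.
Proof.
  induction e as [|e IH]; [rewrite pow_1; apply sum_eigvec_tri|].
  transitivity (sum_n_m (fun k => sum_n_m (fun l =>
    eigvec n k * odd_r k * 2 ^ tri k l * (/ odd_r l * Wsum (repeat 1%nat e) l m)) m k) m n).
  { apply Rsum_n_m_ext_loc. intros k _. simpl repeat. cbn [Wsum]. rewrite <- Rsum_n_m_mult_l.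
    apply Rsum_n_m_ext_loc. intros l _. rewrite pow_1. ring. }
  rewrite sum_n_m_triangle.
  transitivity (sum_n_m (fun l => / odd_r n * (eigvec n l * odd_r l * Wsum (repeat 1%nat e) l m)) m n).
  - apply Rsum_n_m_ext_loc. intros l _.
    rewrite Rsum_n_m_mult_r, sum_eigvec_tri. field. split; apply odd_r_neq0.
  - rewrite Rsum_n_m_mult_l, IH. simpl pow. field. split; [apply odd_r_pow_neq0|apply odd_r_neq0].
Qed.

(* The matrix of f |-> (n |-> sum_(m <= n) f m / (2m-1)^c) in the basis [eigvec], for [c >= 1]. *)
Definition eigmat (c k m : nat) : R :=
  match c with
  | 1%nat => (-1) ^ (k + m) * 2 ^ tri k m / odd_r m
  | 2%nat => if Nat.eqb k m then / odd_r k ^ 2 else 0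
  | _ => Wsum (ones c) k m / (odd_r k * odd_r m ^ 2)
  end.

Lemma eigmat_2_refl (k : nat) : eigmat 2 k k = / odd_r k ^ 2.
Proof. unfold eigmat. now rewrite Nat.eqb_refl. Qed.

Lemma eigmat_2_neq (k m : nat) : k <> m -> eigmat 2 k m = 0.
Proof. intros H. apply Nat.eqb_neq in H. unfold eigmat. now rewrite H. Qed.

Lemma eigmat_2_nonneg (k m : nat) : (1 <= k)%nat -> 0 <= eigmat 2 k m.
Proof.
  intros Hk. unfold eigmat. destruct (Nat.eqb k m); [apply inv_odd_r_pow_nonneg, Hk|apply Rle_refl].
Qed.

Lemma sum_eigmat_2 (f : nat -> R) (k : nat) : (1 <= k)%nat ->
  sum_n_m (fun m => eigmat 2 k m * f m) 1 k = / odd_r k ^ 2 * f k :> R.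
Proof.
  intros Hk. destruct k as [|k]; [lia|]. rewrite Rsum_n_Sm, eigmat_2_refl by lia.
  rewrite (Rsum_n_m_ext_loc _ (fun m => 0 * f m) 1 k).
  - rewrite Rsum_n_m_mult_l. ring.
  - intros m Hm. now rewrite eigmat_2_neq by lia.
Qed.

Lemma eigmat_ge3 (c k m : nat) : (3 <= c)%nat ->
  eigmat c k m = Wsum (ones c) k m / (odd_r k * odd_r m ^ 2).
Proof. intros Hc. destruct c as [|[|[|c]]]; [lia|lia|lia|reflexivity]. Qed.

Lemma sum_eigvec_odd_sqr_eigmat (c n m : nat) : (1 <= c)%nat ->
  sum_n_m (fun k => eigvec n k * (odd_r k ^ 2 * eigmat c k m)) m n =
  odd_r n ^ 2 * / odd_r n ^ c * eigvec n m :> R.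
Proof.
  intros Hc. pose proof (odd_r_neq0 n) as Hn0. pose proof (odd_r_neq0 m) as Hm0.
  destruct c as [|[|[|e]]]; [lia| | |].
  - transitivity (/ odd_r m *
      sum_n_m (fun k => eigvec n k * odd_r k ^ 2 * (-1) ^ (k + m) * 2 ^ tri k m) m n).
    + rewrite <- Rsum_n_m_mult_l. apply Rsum_n_m_ext_loc. intros k _. simpl. field. exact Hm0.
    + rewrite sum_eigvec_alt_tri. field. split; assumption.
  - destruct (le_lt_dec m n) as [Hm|Hm].
    2:{ rewrite Rsum_n_m_empty, eigvec_gt by exact Hm. ring. }
    rewrite (sum_n_m_trailing_zeros (G := R_AbelianMonoid) _ m m n).
    + rewrite sum_n_n, eigmat_2_refl. field. split; assumption.
    + lia.
    + exact Hm.
    + intros k Hk. rewrite eigmat_2_neq, !Rmult_0_r by lia. reflexivity.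
  - transitivity (/ odd_r m ^ 2 *
      sum_n_m (fun k => eigvec n k * odd_r k * Wsum (repeat 1%nat e) k m) m n).
    + rewrite <- Rsum_n_m_mult_l. apply Rsum_n_m_ext_loc. intros k _.
      rewrite eigmat_ge3 by lia. unfold ones. replace (S (S (S e)) - 3)%nat with e by lia.
      field. split; [exact Hm0|apply odd_r_neq0].
    + rewrite sum_eigvec_Wsum. simpl pow. field. repeat split; try assumption. apply odd_r_pow_neq0.
Qed.

(* Both sides have the same increments in [n]. *)
Lemma sum_eigvec_column (c n m : nat) : (1 <= c)%nat -> (1 <= m)%nat ->
  sum_n_m (fun j => / odd_r j ^ c * eigvec j m) m n =
  sum_n_m (fun k => eigvec n k * eigmat c k m) m n :> R.
Proof.
  intros Hc Hm. induction n as [|n IH]; [now rewrite !Rsum_n_m_empty by lia|].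
  destruct (le_lt_dec m (S n)) as [H|H]; [|now rewrite !Rsum_n_m_empty by exact H].
  rewrite (Rsum_n_Sm (fun j => / odd_r j ^ c * eigvec j m)), IH by exact H.
  transitivity (sum_n_m (fun k => eigvec n k * eigmat c k m) m (S n) +
     sum_n_m (fun k => (eigvec (S n) k - eigvec n k) * eigmat c k m) m (S n)).
  - apply (f_equal2 Rplus).
    + rewrite Rsum_n_Sm, (eigvec_gt n (S n)), Rmult_0_l by lia. symmetry. apply Rplus_0_r.
    + transitivity (/ odd_r (S n) ^ 2 *
        sum_n_m (fun k => eigvec (S n) k * (odd_r k ^ 2 * eigmat c k m)) m (S n)).
      { rewrite sum_eigvec_odd_sqr_eigmat by exact Hc. field.
        split; [apply odd_r_pow_neq0|apply odd_r_neq0]. }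
      rewrite <- Rsum_n_m_mult_l. apply Rsum_n_m_ext_loc. intros k Hk.
      rewrite <- Rmult_assoc, eigvec_S_l by lia. field. apply odd_r_neq0.
  - rewrite <- Rsum_n_m_plus. apply Rsum_n_m_ext_loc. intros k _. ring.
Qed.

Fixpoint eigcoord (s : list nat) (k : nat) : R :=
  match s with
  | nil => 1
  | c :: s' => sum_n_m (fun m => eigmat c k m * eigcoord s' m) 1 k
  end.

Lemma tstar_trunc_eigcoord (s : list nat) (n : nat) :
  (forall c, In c s -> (1 <= c)%nat) -> (1 <= n)%nat ->
  tstar_trunc s n = sum_n_m (fun k => eigvec n k * eigcoord s k) 1 n.
Proof.
  revert n. induction s as [|c s IH]; intros n Hs Hn.
  { transitivity (sum_n_m (eigvec n) 1 n); [symmetry; apply sum_eigvec; lia|].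
    apply Rsum_n_m_ext_loc. intros k _. symmetry. apply Rmult_1_r. }
  cbn [tstar_trunc eigcoord].
  transitivity (sum_n_m (fun j => sum_n_m (fun m => / odd_r j ^ c * eigvec j m * eigcoord s m) 1 j) 1 n).
  { apply Rsum_n_m_ext_loc. intros j Hj. rewrite IH; [|intros; apply Hs; now right|lia].
    rewrite <- Rsum_n_m_mult_l. apply Rsum_n_m_ext_loc. intros m _. ring. }
  transitivity (sum_n_m (fun k => sum_n_m (fun m => eigvec n k * eigmat c k m * eigcoord s m) 1 k) 1 n).
  2:{ apply Rsum_n_m_ext_loc. intros k _. rewrite <- Rsum_n_m_mult_l.
      apply Rsum_n_m_ext_loc. intros m _. ring. }
  rewrite !sum_n_m_triangle. apply Rsum_n_m_ext_loc. intros m Hm.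
  rewrite !Rsum_n_m_mult_r. f_equal.
  apply sum_eigvec_column; [apply Hs; now left|lia].
Qed.

(** * Square root weights *)

Lemma one_le_sqrt_INR (k : nat) : (1 <= k)%nat -> 1 <= sqrt (INR k).
Proof. intros Hk. rewrite <- sqrt_1. apply sqrt_le_1_alt, one_le_INR, Hk. Qed.

Lemma inv_sqrt_INR_nonneg (k : nat) : (1 <= k)%nat -> 0 <= / sqrt (INR k).
Proof. intros Hk. pose proof (one_le_sqrt_INR k Hk). apply Rlt_le, Rinv_0_lt_compat. lra. Qed.

Lemma sqrt_INR_sqr (k : nat) : sqrt (INR k) * sqrt (INR k) = INR k.
Proof. apply sqrt_sqrt, pos_INR. Qed.

Lemma sqrt_INR_S_sqr (k : nat) :
  sqrt (INR (S k)) * sqrt (INR (S k)) = sqrt (INR k) * sqrt (INR k) + 1.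
Proof. rewrite !sqrt_INR_sqr. apply S_INR. Qed.

Lemma sum_inv_sqrt_le (k : nat) : sum_n_m (fun m => / sqrt (INR m)) 1 k <= 2 * sqrt (INR k).
Proof.
  induction k as [|k IH].
  - rewrite Rsum_n_m_empty by lia. simpl. rewrite sqrt_0. lra.
  - rewrite Rsum_n_Sm by lia. pose proof (one_le_sqrt_INR (S k) ltac:(lia)) as Hy.
    pose proof (sqrt_INR_S_sqr k) as Hyy. pose proof (sqrt_pos (INR k)) as Hx.
    set (y := sqrt (INR (S k))) in *. set (x := sqrt (INR k)) in *.
    enough (1 / y <= 2 * y - 2 * x) by lra.
    apply Rle_div_l; nra.
Qed.

Lemma sum_inv_mul_sqrt_le (k : nat) : (1 <= k)%nat ->
  sum_n_m (fun m => / (INR m * sqrt (INR m))) 1 k <= 3 - 2 / sqrt (INR k).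
Proof.
  induction 1 as [|k Hk IH].
  - rewrite sum_n_n. simpl. rewrite sqrt_1. lra.
  - rewrite Rsum_n_Sm by lia. pose proof (one_le_sqrt_INR k Hk) as Hx.
    pose proof (one_le_sqrt_INR (S k) ltac:(lia)) as Hy.
    rewrite <- (sqrt_INR_sqr (S k)) at 1.
    pose proof (sqrt_INR_S_sqr k) as Hyy.
    set (y := sqrt (INR (S k))) in *. set (x := sqrt (INR k)) in *.
    enough (/ (y * y * y) <= 2 / x - 2 / y) by lra.
    assert (Hxy : (y - x) * (y + x) = 1) by nra.
    assert (Hlt : x < y) by nra.
    replace (2 / x - 2 / y) with (2 * (y - x) * (y * y) / x * / (y * y * y)) by (field; lra).
    rewrite <- (Rmult_1_l (/ (y * y * y))) at 1. apply Rmult_le_compat_r.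
    + apply Rlt_le, Rinv_0_lt_compat. repeat apply Rmult_lt_0_compat; lra.
    + apply Rle_div_r; [lra|]. nra.
Qed.

Lemma sum_inv_mul_sqrt_le3 (k : nat) : sum_n_m (fun m => / (INR m * sqrt (INR m))) 1 k <= 3.
Proof.
  destruct k as [|k]; [rewrite Rsum_n_m_empty by lia; lra|].
  pose proof (sum_inv_mul_sqrt_le (S k) ltac:(lia)).
  pose proof (inv_sqrt_INR_nonneg (S k) ltac:(lia)). lra.
Qed.

Lemma ex_series_inv_mul_sqrt : ex_series (fun k => / (INR (S k) * sqrt (INR (S k)))).
Proof.
  apply ex_finite_lim_seq_incr with 3; intros n.
  - rewrite sum_Sn. rewrite <- (Rplus_0_r (sum_n _ n)) at 1. apply Rplus_le_compat_l.
    pose proof (one_le_INR (S (S n)) ltac:(lia)). pose proof (one_le_sqrt_INR (S (S n)) ltac:(lia)).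
    apply Rlt_le, Rinv_0_lt_compat, Rmult_lt_0_compat; lra.
  - unfold sum_n. rewrite (sum_n_m_S (fun k => / (INR k * sqrt (INR k)))). apply sum_inv_mul_sqrt_le3.
Qed.

Lemma inv_odd_r_mul_sqrt_le (k : nat) : (1 <= k)%nat -> / odd_r k * sqrt (INR k) <= / sqrt (INR k).
Proof.
  intros Hk. pose proof (one_le_sqrt_INR k Hk).
  transitivity (/ INR k * sqrt (INR k)).
  - apply Rmult_le_compat_r; [apply sqrt_pos|apply inv_odd_r_le_inv_INR, Hk].
  - right. rewrite <- sqrt_INR_sqr at 1. field. lra.
Qed.

Lemma inv_odd_r_sqr_mul_sqrt_le (k : nat) : (1 <= k)%nat ->
  / odd_r k ^ 2 * sqrt (INR k) <= / (INR k * sqrt (INR k)).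
Proof.
  intros Hk. rewrite Rinv_mult. replace (/ odd_r k ^ 2) with (/ odd_r k * / odd_r k)
    by (field; apply odd_r_neq0).
  rewrite Rmult_assoc. apply Rmult_le_compat.
  - apply inv_odd_r_nonneg, Hk.
  - apply Rmult_le_pos; [apply inv_odd_r_nonneg, Hk|apply sqrt_pos].
  - apply inv_odd_r_le_inv_INR, Hk.
  - apply inv_odd_r_mul_sqrt_le, Hk.
Qed.

(** * Convergence of the truncated t-star sums *)

Lemma tstar_trunc_nonneg (s : list nat) (n : nat) : 0 <= tstar_trunc s n.
Proof.
  revert n. induction s as [|c s IH]; intros n; cbn [tstar_trunc]; [lra|].
  apply sum_n_m_nonneg. intros k Hk. apply Rmult_le_pos; [|apply IH].
  apply inv_odd_r_pow_nonneg. lia.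
Qed.

Lemma tstar_trunc_incr (s : list nat) (n : nat) : tstar_trunc s n <= tstar_trunc s (S n).
Proof.
  destruct s as [|c s]; cbn [tstar_trunc]; [lra|]. rewrite Rsum_n_Sm by lia.
  pose proof (tstar_trunc_nonneg s (S n)). pose proof (inv_odd_r_pow_nonneg (S n) c ltac:(lia)). nra.
Qed.

Lemma tstar_trunc_le_sqrt (s : list nat) (n : nat) :
  (forall c, In c s -> (1 <= c)%nat) -> (1 <= n)%nat ->
  tstar_trunc s n <= 2 ^ length s * sqrt (INR n).
Proof.
  revert n. induction s as [|c s IH]; intros n Hs Hn; cbn [tstar_trunc length].
  { pose proof (one_le_sqrt_INR n Hn). simpl. lra. }
  transitivity (sum_n_m (fun k => 2 ^ length s * / sqrt (INR k)) 1 n).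
  - apply sum_n_m_le_loc. intros k Hk.
    transitivity (/ odd_r k * (2 ^ length s * sqrt (INR k))).
    + apply Rmult_le_compat.
      * apply inv_odd_r_pow_nonneg. lia.
      * apply tstar_trunc_nonneg.
      * rewrite <- (pow_1 (odd_r k)) at 2. apply inv_odd_r_pow_le; [lia|]. apply Hs. now left.
      * apply IH; [intros; apply Hs; now right|lia].
    + rewrite (Rmult_comm (/ odd_r k)), Rmult_assoc. apply Rmult_le_compat_l; [apply pow_le; lra|].
      rewrite Rmult_comm. apply inv_odd_r_mul_sqrt_le. lia.
  - rewrite Rsum_n_m_mult_l. pose proof (sum_inv_sqrt_le n).
    assert (0 < 2 ^ length s) by (apply pow_lt; lra). simpl. nra.
Qed.

Lemma tstar_trunc_bounded (c : nat) (s : list nat) (n : nat) :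
  (2 <= c)%nat -> (forall x, In x s -> (1 <= x)%nat) ->
  tstar_trunc (c :: s) n <= 2 ^ length s * 3.
Proof.
  intros Hc Hs. cbn [tstar_trunc].
  transitivity (sum_n_m (fun k => 2 ^ length s * / (INR k * sqrt (INR k))) 1 n).
  2:{ rewrite Rsum_n_m_mult_l. apply Rmult_le_compat_l; [apply pow_le; lra|apply sum_inv_mul_sqrt_le3]. }
  apply sum_n_m_le_loc. intros k Hk.
  transitivity (/ odd_r k ^ 2 * (2 ^ length s * sqrt (INR k))).
  - apply Rmult_le_compat.
    + apply inv_odd_r_pow_nonneg. lia.
    + apply tstar_trunc_nonneg.
    + apply inv_odd_r_pow_le; [lia|exact Hc].
    + apply tstar_trunc_le_sqrt; [exact Hs|lia].
  - rewrite <- Rmult_assoc, (Rmult_comm (/ _)), Rmult_assoc.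
    apply Rmult_le_compat_l; [apply pow_le; lra|]. apply inv_odd_r_sqr_mul_sqrt_le. lia.
Qed.

Lemma is_lim_seq_tstar (s : list nat) :
  (forall c, In c s -> (1 <= c)%nat) -> (2 <= hd 2 s)%nat ->
  is_lim_seq (tstar_trunc s) (tstar s).
Proof.
  intros Hs Hhd. apply Lim_seq_correct'. destruct s as [|c s].
  - exists 1. apply is_lim_seq_const.
  - apply ex_finite_lim_seq_incr with (2 ^ length s * 3); intros n; [apply tstar_trunc_incr|].
    apply tstar_trunc_bounded; [exact Hhd|]. intros x Hx. apply Hs. now right.
Qed.

(** * Growth of the conjugated operators *)

Lemma pow_tri_bounds (k m : nat) : 0 <= 2 ^ tri k m <= 2.
Proof. unfold tri. destruct (Nat.eqb k m); simpl; lra. Qed.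

Lemma Wsum_nonneg (s : list nat) (k m : nat) : (1 <= m)%nat -> 0 <= Wsum s k m.
Proof.
  intros Hm. revert k. induction s as [|a s IH]; intros k; cbn [Wsum]; [apply pow_tri_bounds|].
  apply sum_n_m_nonneg. intros l Hl. repeat apply Rmult_le_pos.
  - apply pow_tri_bounds.
  - apply inv_odd_r_pow_nonneg. lia.
  - apply IH.
Qed.

Lemma sum_Wsum_cons (a : nat) (s : list nat) (f : nat -> R) (k : nat) :
  sum_n_m (fun m => Wsum (a :: s) k m * f m) 1 k =
  sum_n_m (fun l => 2 ^ tri k l * / odd_r l ^ a * sum_n_m (fun m => Wsum s l m * f m) 1 l) 1 k :> R.
Proof.
  transitivity (sum_n_m (fun l => sum_n_m (fun m =>
    2 ^ tri k l * / odd_r l ^ a * (Wsum s l m * f m)) 1 l) 1 k).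
  - rewrite sum_n_m_triangle. apply Rsum_n_m_ext_loc. intros m _. cbn [Wsum].
    rewrite <- Rsum_n_m_mult_r. apply Rsum_n_m_ext_loc. intros l _. ring.
  - apply Rsum_n_m_ext_loc. intros l _. apply Rsum_n_m_mult_l.
Qed.

Lemma sum_Wsum_inv_sqrt_le (e k : nat) :
  sum_n_m (fun m => Wsum (repeat 1%nat e) k m * / sqrt (INR m)) 1 k <= 4 ^ S e * sqrt (INR k).
Proof.
  revert k. induction e as [|e IH]; intros k.
  - transitivity (sum_n_m (fun m => 2 * / sqrt (INR m)) 1 k).
    + apply sum_n_m_le_loc. intros m Hm.
      apply Rmult_le_compat_r; [apply inv_sqrt_INR_nonneg; lia|apply pow_tri_bounds].
    + rewrite Rsum_n_m_mult_l. pose proof (sum_inv_sqrt_le k). simpl. lra.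
  - simpl repeat. rewrite sum_Wsum_cons.
    transitivity (sum_n_m (fun l => 2 * 4 ^ S e * / sqrt (INR l)) 1 k).
    + apply sum_n_m_le_loc. intros l Hl. rewrite pow_1.
      pose proof (inv_odd_r_nonneg l ltac:(lia)). pose proof (pow_tri_bounds k l).
      transitivity (2 * / odd_r l * (4 ^ S e * sqrt (INR l))).
      * apply Rmult_le_compat; [nra| |nra|apply IH].
        apply sum_n_m_nonneg. intros m Hm.
        apply Rmult_le_pos; [apply Wsum_nonneg; lia|apply inv_sqrt_INR_nonneg; lia].
      * replace (2 * / odd_r l * (4 ^ S e * sqrt (INR l)))
          with (2 * 4 ^ S e * (/ odd_r l * sqrt (INR l))) by ring.
        apply Rmult_le_compat_l; [|apply inv_odd_r_mul_sqrt_le; lia].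
        apply Rmult_le_pos; [lra|apply pow_le; lra].
    + rewrite Rsum_n_m_mult_l. pose proof (sum_inv_sqrt_le k).
      assert (0 < 4 ^ S e) by (apply pow_lt; lra). change (4 ^ S (S e)) with (4 * 4 ^ S e). nra.
Qed.

(* The operators send O(sqrt k) to O(sqrt k), and even to O(1 / sqrt k) when c >= 2; as the
   eigenvectors are O(1 / k), this is enough for absolute convergence. *)
Definition eigmat_sqrt_sum (c k : nat) : R :=
  sum_n_m (fun m => Rabs (eigmat c k m) * sqrt (INR m)) 1 k.

Lemma eigmat_sqrt_sum_nonneg (c k : nat) : 0 <= eigmat_sqrt_sum c k.
Proof.
  apply sum_n_m_nonneg. intros m _. apply Rmult_le_pos; [apply Rabs_pos|apply sqrt_pos].
Qed.

Lemma eigmat_sqrt_sum_1_le (k : nat) : eigmat_sqrt_sum 1 k <= 4 * sqrt (INR k).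
Proof.
  transitivity (sum_n_m (fun m => 2 * / sqrt (INR m)) 1 k).
  - apply sum_n_m_le_loc. intros m Hm. cbn [eigmat]. pose proof (pow_tri_bounds k m).
    pose proof (inv_odd_r_nonneg m ltac:(lia)).
    unfold Rdiv. rewrite !Rabs_mult, pow_1_abs, Rmult_1_l, !Rabs_pos_eq, Rmult_assoc by lra.
    apply Rmult_le_compat; try lra.
    + apply Rmult_le_pos; [assumption|apply sqrt_pos].
    + apply inv_odd_r_mul_sqrt_le. lia.
  - rewrite Rsum_n_m_mult_l. pose proof (sum_inv_sqrt_le k). lra.
Qed.

Lemma eigmat_sqrt_sum_2_le (k : nat) : (1 <= k)%nat -> eigmat_sqrt_sum 2 k <= / sqrt (INR k).
Proof.
  intros Hk. unfold eigmat_sqrt_sum.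
  rewrite (Rsum_n_m_ext_loc _ (fun m => eigmat 2 k m * sqrt (INR m)) 1 k).
  - rewrite sum_eigmat_2 by exact Hk. transitivity (/ odd_r k ^ 1 * sqrt (INR k)).
    + apply Rmult_le_compat_r; [apply sqrt_pos|]. apply inv_odd_r_pow_le; [exact Hk|lia].
    + rewrite pow_1. apply inv_odd_r_mul_sqrt_le, Hk.
  - intros m _. now rewrite Rabs_pos_eq by apply eigmat_2_nonneg, Hk.
Qed.

Lemma eigmat_sqrt_sum_ge3_le (c k : nat) : (3 <= c)%nat -> (1 <= k)%nat ->
  eigmat_sqrt_sum c k <= 4 ^ (c - 2) * / sqrt (INR k).
Proof.
  intros Hc Hk.
  transitivity (/ odd_r k * sum_n_m (fun m => Wsum (ones c) k m * / sqrt (INR m)) 1 k).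
  - rewrite <- Rsum_n_m_mult_l. apply sum_n_m_le_loc. intros m Hm. rewrite eigmat_ge3 by exact Hc.
    pose proof (Wsum_nonneg (ones c) k m ltac:(lia)) as HW.
    pose proof (inv_odd_r_nonneg k Hk). pose proof (inv_odd_r_pow_nonneg m 2 ltac:(lia)).
    unfold Rdiv. rewrite Rinv_mult, Rabs_pos_eq by (repeat apply Rmult_le_pos; assumption).
    replace (Wsum (ones c) k m * (/ odd_r k * / odd_r m ^ 2) * sqrt (INR m))
      with (/ odd_r k * (Wsum (ones c) k m * (/ odd_r m ^ 2 * sqrt (INR m)))) by ring.
    do 2 (apply Rmult_le_compat_l; [assumption|]).
    transitivity (/ odd_r m ^ 1 * sqrt (INR m)).
    + apply Rmult_le_compat_r; [apply sqrt_pos|]. apply inv_odd_r_pow_le; lia.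
    + rewrite pow_1. apply inv_odd_r_mul_sqrt_le. lia.
  - transitivity (/ odd_r k * (4 ^ (c - 2) * sqrt (INR k))).
    + apply Rmult_le_compat_l; [apply inv_odd_r_nonneg, Hk|].
      replace (c - 2)%nat with (S (c - 3)) by lia. apply sum_Wsum_inv_sqrt_le.
    + rewrite (Rmult_comm (/ _)), Rmult_assoc, (Rmult_comm (sqrt _)).
      apply Rmult_le_compat_l; [apply pow_le; lra|apply inv_odd_r_mul_sqrt_le, Hk].
Qed.

Lemma eigmat_sqrt_sum_ge2_le (c k : nat) : (2 <= c)%nat -> (1 <= k)%nat ->
  eigmat_sqrt_sum c k <= 4 ^ c * / sqrt (INR k).
Proof.
  intros Hc Hk. pose proof (inv_sqrt_INR_nonneg k Hk).
  destruct (Nat.eq_dec c 2) as [->|Hc2].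
  - pose proof (eigmat_sqrt_sum_2_le k Hk). simpl pow. lra.
  - apply Rle_trans with (1 := eigmat_sqrt_sum_ge3_le c k ltac:(lia) Hk).
    apply Rmult_le_compat_r; [assumption|]. apply Rle_pow; [lra|lia].
Qed.

Lemma eigmat_sqrt_sum_ge1_le (c k : nat) : (1 <= c)%nat -> (1 <= k)%nat ->
  eigmat_sqrt_sum c k <= 4 ^ c * sqrt (INR k).
Proof.
  intros Hc Hk. destruct (Nat.eq_dec c 1) as [->|Hc1].
  - rewrite pow_1. apply eigmat_sqrt_sum_1_le.
  - apply Rle_trans with (1 := eigmat_sqrt_sum_ge2_le c k ltac:(lia) Hk).
    pose proof (one_le_sqrt_INR k Hk). apply Rmult_le_compat_l; [apply pow_le; lra|].
    transitivity 1; [|assumption]. rewrite <- Rinv_1. apply Rinv_le_contravar; lra.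
Qed.

(** * Nested sums of conjugated operators *)

Fixpoint eigchain (d : nat) (c : nat -> nat) (g : nat -> nat -> C) (k : nat) : C :=
  match d with
  | O => g 0%nat k
  | S d' => (g 0%nat k * sum_n_m (fun m => (RtoC (eigmat (c 1%nat) k m) *
              eigchain d' (fun i => c (S i)) (fun i => g (S i)) m)%C) 1 k)%C
  end.

Lemma eigchain_ext (d : nat) (c c' : nat -> nat) (g g' : nat -> nat -> C) (k : nat) :
  (forall i, (1 <= i <= d)%nat -> c i = c' i) ->
  (forall i m, (i <= d)%nat -> (1 <= m)%nat -> g i m = g' i m) -> (1 <= k)%nat ->
  eigchain d c g k = eigchain d c' g' k.
Proof.
  revert c c' g g' k. induction d as [|d IH]; intros c c' g g' k Hc Hg Hk; cbn [eigchain].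
  - apply Hg; [lia|exact Hk].
  - rewrite (Hg 0%nat), (Hc 1%nat) by lia. f_equal. apply Csum_n_m_ext_loc. intros m Hm. f_equal.
    apply IH; [intros; apply Hc; lia|intros; apply Hg; lia|lia].
Qed.

Lemma filterlim_eigchain {T : Type} {F : (T -> Prop) -> Prop} {FF : Filter F}
  (d : nat) (c : nat -> nat) (f : T -> nat -> nat -> C) (g : nat -> nat -> C) (k : nat) :
  (forall i m, (i <= d)%nat -> (1 <= m)%nat -> filterlim (fun x => f x i m) F (locally (g i m))) ->
  (1 <= k)%nat ->
  filterlim (fun x => eigchain d c (f x) k) F (locally (eigchain d c g k)).
Proof.
  revert c f g k. induction d as [|d IH]; intros c f g k Hf Hk; cbn [eigchain].
  - apply Hf; [lia|exact Hk].
  - apply filterlim_Cmult; [apply Hf; lia|].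
    apply (filterlim_sum_n_m (V := C_NormedModule) (fun x m => (RtoC (eigmat (c 1%nat) k m) *
      eigchain d (fun i => c (S i)) (fun i => f x (S i)) m)%C)).
    intros m Hm. apply filterlim_Cmult; [apply filterlim_const|].
    apply (IH (fun i => c (S i)) (fun x i => f x (S i)) (fun i => g (S i))); [|lia].
    intros i j Hi Hj. apply Hf; lia.
Qed.

Lemma Cmod_sum_eigmat_le (c k : nat) (B : R) (t : nat -> C) :
  (forall m, (1 <= m)%nat -> Cmod (t m) <= B * sqrt (INR m)) ->
  Cmod (sum_n_m (fun m => (RtoC (eigmat c k m) * t m)%C) 1 k) <= B * eigmat_sqrt_sum c k.
Proof.
  intros Ht.
  apply Rle_trans with (1 := norm_sum_n_m (V := C_NormedModule)
    (fun m => (RtoC (eigmat c k m) * t m)%C) 1 k).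
  unfold eigmat_sqrt_sum. rewrite <- Rsum_n_m_mult_l. apply sum_n_m_le_loc. intros m Hm.
  change (Cmod (RtoC (eigmat c k m) * t m) <= B * (Rabs (eigmat c k m) * sqrt (INR m))).
  rewrite Cmod_mult, Cmod_R, (Rmult_comm B), Rmult_assoc, (Rmult_comm _ B).
  apply Rmult_le_compat_l; [apply Rabs_pos|]. apply Ht. lia.
Qed.

Lemma Cmod_eigchain_S_le (d : nat) (c : nat -> nat) (g : nat -> nat -> C) (G A : R) (k : nat) :
  0 <= A -> (forall m, (1 <= m)%nat -> Cmod (g 1%nat m) <= G) ->
  (forall m, (1 <= m)%nat -> Cmod (eigchain d (fun i => c (S i)) (fun i => g (S i)) m) <=
    Cmod (g 1%nat m) * (A * sqrt (INR m))) ->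
  Cmod (eigchain (S d) c g k) <= Cmod (g 0%nat k) * (G * A * eigmat_sqrt_sum (c 1%nat) k).
Proof.
  intros HA Hg Hchain. cbn [eigchain]. rewrite Cmod_mult.
  apply Rmult_le_compat_l; [apply Cmod_ge_0|].
  apply Cmod_sum_eigmat_le. intros m Hm. rewrite Rmult_assoc.
  apply Rle_trans with (1 := Hchain m Hm).
  apply Rmult_le_compat_r; [|apply Hg, Hm]. apply Rmult_le_pos; [exact HA|apply sqrt_pos].
Qed.

Lemma eigchain_le_sqrt (d : nat) (c : nat -> nat) (G : R) :
  (forall i, (1 <= i <= d)%nat -> (1 <= c i)%nat) -> 0 <= G ->
  exists A, 0 <= A /\ forall g,
    (forall i m, (1 <= i <= d)%nat -> (1 <= m)%nat -> Cmod (g i m) <= G) ->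
    forall k, (1 <= k)%nat -> Cmod (eigchain d c g k) <= Cmod (g 0%nat k) * (A * sqrt (INR k)).
Proof.
  revert c. induction d as [|d IH]; intros c Hc HG.
  - exists 1. split; [lra|]. intros g _ k Hk. cbn [eigchain].
    pose proof (one_le_sqrt_INR k Hk). pose proof (Cmod_ge_0 (g 0%nat k)). nra.
  - destruct (IH (fun i => c (S i))) as [A [HA H]]; [intros; apply Hc; lia|exact HG|].
    assert (HGA : 0 <= G * A) by (apply Rmult_le_pos; assumption).
    exists (G * A * 4 ^ c 1%nat). split; [apply Rmult_le_pos; [exact HGA|apply pow_le; lra]|].
    intros g Hg k Hk. apply Rle_trans with (Cmod (g 0%nat k) * (G * A * eigmat_sqrt_sum (c 1%nat) k)).
    + apply Cmod_eigchain_S_le; [exact HA|intros; apply Hg; lia|].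
      apply (H (fun i => g (S i))). intros; apply Hg; lia.
    + apply Rmult_le_compat_l; [apply Cmod_ge_0|]. rewrite (Rmult_assoc (G * A)).
      apply Rmult_le_compat_l; [exact HGA|]. apply eigmat_sqrt_sum_ge1_le; [apply Hc; lia|exact Hk].
Qed.

Lemma eigchain_decay_of_exponent (d : nat) (c : nat -> nat) (G : R) :
  (1 <= d)%nat -> (forall i, (1 <= i <= d)%nat -> (1 <= c i)%nat) -> (2 <= c 1)%nat -> 0 <= G ->
  exists A, forall g,
    (forall i m, (i <= d)%nat -> (1 <= m)%nat -> Cmod (g i m) <= G) ->
    forall k, (1 <= k)%nat -> Cmod (eigchain d c g k) <= A / sqrt (INR k).
Proof.
  intros Hd Hc Hc1 HG. destruct d as [|d]; [lia|].
  destruct (eigchain_le_sqrt d (fun i => c (S i)) G) as [A [HA H]]; [intros; apply Hc; lia|exact HG|].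
  assert (HGA : 0 <= G * A) by (apply Rmult_le_pos; assumption).
  exists (G * (G * A * 4 ^ c 1%nat)). intros g Hg k Hk.
  apply Rle_trans with (Cmod (g 0%nat k) * (G * A * eigmat_sqrt_sum (c 1%nat) k)).
  - apply Cmod_eigchain_S_le; [exact HA|intros; apply Hg; lia|].
    apply (H (fun i => g (S i))). intros; apply Hg; lia.
  - pose proof (eigmat_sqrt_sum_ge2_le (c 1%nat) k Hc1 Hk).
    transitivity (G * (G * A * eigmat_sqrt_sum (c 1%nat) k)).
    + apply Rmult_le_compat_r; [|apply Hg; lia]. apply Rmult_le_pos; [exact HGA|].
      apply eigmat_sqrt_sum_nonneg.
    + replace (G * (G * A * 4 ^ c 1%nat) / sqrt (INR k))
        with (G * (G * A * (4 ^ c 1%nat * / sqrt (INR k)))) by (unfold Rdiv; ring).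
      do 2 (apply Rmult_le_compat_l; [assumption|]). assumption.
Qed.

Lemma eigchain_decay_of_head (d : nat) (c : nat -> nat) (G : R) :
  (forall i, (1 <= i <= d)%nat -> (1 <= c i)%nat) -> 0 <= G ->
  exists A, forall g,
    (forall i m, (1 <= i <= d)%nat -> (1 <= m)%nat -> Cmod (g i m) <= G) ->
    (forall m, (1 <= m)%nat -> Cmod (g 0%nat m) <= G / INR m ^ 2) ->
    forall k, (1 <= k)%nat -> Cmod (eigchain d c g k) <= A / sqrt (INR k).
Proof.
  intros Hc HG. destruct (eigchain_le_sqrt d c G Hc HG) as [A [HA H]].
  exists (G * A). intros g Hg Hg0 k Hk.
  pose proof (one_le_INR k Hk). pose proof (one_le_sqrt_INR k Hk).
  apply Rle_trans with (1 := H g Hg k Hk).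
  transitivity (G / INR k ^ 2 * (A * sqrt (INR k))).
  { apply Rmult_le_compat_r; [apply Rmult_le_pos; lra|apply Hg0, Hk]. }
  replace (G / INR k ^ 2 * (A * sqrt (INR k))) with (G * A * (/ INR k * (sqrt (INR k) / INR k)))
    by (field; lra).
  apply Rmult_le_compat_l; [apply Rmult_le_pos; assumption|].
  replace (sqrt (INR k) / INR k) with (/ sqrt (INR k)) by (rewrite <- (sqrt_INR_sqr k) at 3; field; lra).
  rewrite <- (Rmult_1_l (/ sqrt (INR k))) at 2.
  apply Rmult_le_compat_r; [apply inv_sqrt_INR_nonneg, Hk|].
  rewrite <- Rinv_1. apply Rinv_le_contravar; lra.
Qed.

Lemma eigchain_decay (d u : nat) (c : nat -> nat) (G : R) :
  (u <= d)%nat -> (forall i, (1 <= i <= d)%nat -> (1 <= c i)%nat) ->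
  ((1 <= u)%nat -> (2 <= c 1)%nat) -> 0 <= G ->
  exists A, forall g,
    (forall i m, (i <= d)%nat -> (1 <= m)%nat -> Cmod (g i m) <= G) ->
    (forall m, (1 <= m)%nat -> Cmod (g u m) <= G / INR m ^ 2) ->
    forall k, (1 <= k)%nat -> Cmod (eigchain d c g k) <= A / sqrt (INR k).
Proof.
  intros Hu Hc Hc1 HG. destruct u as [|u].
  - destruct (eigchain_decay_of_head d c G Hc HG) as [A H]. exists A. intros g Hg Hgu.
    apply H; [intros; apply Hg; lia|exact Hgu].
  - destruct (eigchain_decay_of_exponent d c G) as [A H]; [lia|exact Hc|apply Hc1; lia|exact HG|].
    exists A. intros g Hg _. apply H, Hg.
Qed.

(** * Summation over the exponents *)

Lemma Cprod_seq_S (f : nat -> C) (n : nat) :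
  Cprod (map f (seq 0 (S n))) = (f 0%nat * Cprod (map (fun i => f (S i)) (seq 0 n)))%C.
Proof. simpl. rewrite <- seq_shift, map_map. reflexivity. Qed.

Lemma Cprod_seq_mult_at (f : nat -> C) (x : C) (u n : nat) : (u < n)%nat ->
  Cprod (map (fun i => (f i * (if Nat.eqb i u then x else RtoC 1))%C) (seq 0 n)) =
  (x * Cprod (map f (seq 0 n)))%C.
Proof.
  revert f u. induction n as [|n IH]; intros f u Hu; [lia|].
  rewrite !Cprod_seq_S. destruct u as [|u]; simpl Nat.eqb.
  - rewrite (map_ext (fun i => (f (S i) * RtoC 1)%C) (fun i => f (S i))) by (intros; ring). ring.
  - rewrite (IH (fun i => f (S i)) u) by lia. ring.
Qed.

Lemma boxsum_S (n N : nat) (F : list nat -> C) :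
  boxsum (S n) N F = sum_n_m (fun a => boxsum n N (fun l => F (a :: l))) 0 N.
Proof. reflexivity. Qed.

Lemma boxsum_ext (n N : nat) (F G : list nat -> C) :
  (forall l, F l = G l) -> boxsum n N F = boxsum n N G.
Proof.
  revert F G. induction n as [|n IH]; intros F G H; cbn [boxsum]; [apply H|].
  apply Csum_n_m_ext_loc. intros a _. apply IH. intros l. apply H.
Qed.

Lemma boxsum_mult_l (n N : nat) (x : C) (F : list nat -> C) :
  boxsum n N (fun l => (x * F l)%C) = (x * boxsum n N F)%C.
Proof.
  revert F. induction n as [|n IH]; intros F; cbn [boxsum]; [reflexivity|].
  rewrite <- Csum_n_m_mult_l. apply Csum_n_m_ext_loc. intros a _. apply (IH (fun l => F (a :: l))).
Qed.

Lemma boxsum_sum_n_m (n N p q : nat) (F : nat -> list nat -> C) :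
  boxsum n N (fun l => sum_n_m (fun m => F m l) p q) = sum_n_m (fun m => boxsum n N (F m)) p q.
Proof.
  revert F. induction n as [|n IH]; intros F; cbn [boxsum]; [reflexivity|].
  rewrite (sum_n_m_exchange (fun m a => boxsum n N (fun l => F m (a :: l))) p q 0 N).
  apply Csum_n_m_ext_loc. intros a _. apply (IH (fun m l => F m (a :: l))).
Qed.

Lemma filterlim_boxsum {T : Type} {Fil : (T -> Prop) -> Prop} {FF : Filter Fil}
  (n N : nat) (F : T -> list nat -> C) (G : list nat -> C) :
  (forall l, filterlim (fun x => F x l) Fil (locally (G l))) ->
  filterlim (fun x => boxsum n N (F x)) Fil (locally (boxsum n N G)).
Proof.
  revert F G. induction n as [|n IH]; intros F G H; cbn [boxsum]; [apply H|].
  apply (filterlim_sum_n_m (V := C_NormedModule) (fun x a => boxsum n N (fun l => F x (a :: l)))).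
  intros a _. apply (IH (fun x l => F x (a :: l))). intros l. apply H.
Qed.

Lemma lhs_index_cons (d : nat) (c : nat -> nat) (a0 : nat) (a : list nat) :
  lhs_index (S d) c (a0 :: a) = repeat 2%nat a0 ++ c 1%nat :: lhs_index d (fun i => c (S i)) a.
Proof.
  unfold lhs_index. simpl. do 3 f_equal.
  rewrite <- (seq_shift d 1), !flat_map_concat_map, map_map. reflexivity.
Qed.

Lemma lhs_index_ge1 (d : nat) (c : nat -> nat) (a : list nat) :
  (forall i, (1 <= i <= d)%nat -> (1 <= c i)%nat) ->
  forall x, In x (lhs_index d c a) -> (1 <= x)%nat.
Proof.
  intros Hc x Hx. apply in_app_or in Hx. destruct Hx as [Hx|Hx].
  - apply repeat_spec in Hx. lia.
  - apply in_flat_map in Hx. destruct Hx as [i [Hi [<-|Hx]]].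
    + apply in_seq in Hi. apply Hc. lia.
    + apply repeat_spec in Hx. lia.
Qed.

Lemma hd_lhs_index_ge2 (d u : nat) (c : nat -> nat) (a : list nat) :
  (u <= d)%nat -> ((1 <= u)%nat -> (2 <= c 1)%nat) -> nth u a 0%nat <> 0%nat ->
  (2 <= hd 2 (lhs_index d c a))%nat.
Proof.
  intros Hu Hc1 Ha. unfold lhs_index. destruct (nth 0 a 0%nat) as [|a0] eqn:E; [|simpl; lia].
  destruct u as [|u]; [contradiction|]. destruct d as [|d]; [lia|]. simpl. apply Hc1. lia.
Qed.

Lemma eigcoord_repeat2 (a : nat) (s : list nat) (k : nat) : (1 <= k)%nat ->
  eigcoord (repeat 2%nat a ++ s) k = (/ odd_r k ^ 2) ^ a * eigcoord s k.
Proof.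
  intros Hk. induction a as [|a IH]; [simpl; ring|].
  cbn [repeat app eigcoord]. rewrite sum_eigmat_2, IH by exact Hk. simpl pow. ring.
Qed.

Lemma eigcoord_lhs_index_O (c : nat -> nat) (a : list nat) (k : nat) : (1 <= k)%nat ->
  eigcoord (lhs_index 0 c a) k = (/ odd_r k ^ 2) ^ nth 0 a 0%nat.
Proof.
  intros Hk. unfold lhs_index. simpl flat_map. rewrite eigcoord_repeat2 by exact Hk. simpl. ring.
Qed.

Lemma eigcoord_lhs_index_S (d : nat) (c : nat -> nat) (a0 : nat) (a : list nat) (k : nat) :
  (1 <= k)%nat ->
  eigcoord (lhs_index (S d) c (a0 :: a)) k = (/ odd_r k ^ 2) ^ a0 *
    sum_n_m (fun m => eigmat (c 1%nat) k m * eigcoord (lhs_index d (fun i => c (S i)) a) m) 1 k.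
Proof. intros Hk. rewrite lhs_index_cons, eigcoord_repeat2 by exact Hk. reflexivity. Qed.

Definition block (v : nat -> nat -> C) (N i k : nat) : C :=
  sum_n_m (fun a => (v i a * RtoC ((/ odd_r k ^ 2) ^ a))%C) 0 N.

Lemma boxsum_eigcoord (d N : nat) (c : nat -> nat) (v : nat -> nat -> C) (k : nat) : (1 <= k)%nat ->
  boxsum (S d) N (fun a => (RtoC (eigcoord (lhs_index d c a) k) *
    Cprod (map (fun i => v i (nth i a 0%nat)) (seq 0 (S d))))%C) =
  eigchain d c (block v N) k.
Proof.
  revert c v k. induction d as [|d IH]; intros c v k Hk.
  { apply Csum_n_m_ext_loc. intros a _. cbn [boxsum].
    rewrite eigcoord_lhs_index_O by exact Hk. simpl. ring. }
  rewrite (boxsum_S (S d)).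
  transitivity (sum_n_m (fun a0 => ((v 0%nat a0 * RtoC ((/ odd_r k ^ 2) ^ a0)) *
    sum_n_m (fun m => RtoC (eigmat (c 1%nat) k m) *
      eigchain d (fun i => c (S i)) (block (fun i => v (S i)) N) m) 1 k)%C) 0 N).
  2:{ rewrite Csum_n_m_mult_r. reflexivity. }
  apply Csum_n_m_ext_loc. intros a0 _.
  transitivity (boxsum (S d) N (fun a => ((v 0%nat a0 * RtoC ((/ odd_r k ^ 2) ^ a0)) *
    sum_n_m (fun m => RtoC (eigmat (c 1%nat) k m) *
      (RtoC (eigcoord (lhs_index d (fun i => c (S i)) a) m) *
       Cprod (map (fun i => v (S i) (nth i a 0%nat)) (seq 0 (S d))))) 1 k)%C)).
  - apply boxsum_ext. intros a.
    rewrite eigcoord_lhs_index_S, RtoC_mult, RtoC_sum_n_m, (Cprod_seq_S _ (S d)) by exact Hk.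
    cbn [nth]. set (P := Cprod _).
    transitivity (v 0%nat a0 * RtoC ((/ odd_r k ^ 2) ^ a0) *
      (sum_n_m (fun m => RtoC (eigmat (c 1%nat) k m *
         eigcoord (lhs_index d (fun i => c (S i)) a) m)) 1 k * P))%C; [ring|].
    f_equal. rewrite <- Csum_n_m_mult_r. apply Csum_n_m_ext_loc. intros m _. rewrite RtoC_mult. ring.
  - rewrite boxsum_mult_l. f_equal.
    rewrite (boxsum_sum_n_m (S d) N 1 k (fun m a => (RtoC (eigmat (c 1%nat) k m) *
      (RtoC (eigcoord (lhs_index d (fun i => c (S i)) a) m) *
       Cprod (map (fun i => v (S i) (nth i a 0%nat)) (seq 0 (S d)))))%C)).
    apply Csum_n_m_ext_loc. intros m Hm. rewrite boxsum_mult_l. f_equal.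
    apply (IH (fun i => c (S i)) (fun i => v (S i))). lia.
Qed.

Lemma boxsum_tstar_trunc (d N n : nat) (c : nat -> nat) (v : nat -> nat -> C) :
  (forall i, (1 <= i <= d)%nat -> (1 <= c i)%nat) -> (1 <= n)%nat ->
  boxsum (S d) N (fun a => (RtoC (tstar_trunc (lhs_index d c a) n) *
    Cprod (map (fun i => v i (nth i a 0%nat)) (seq 0 (S d))))%C) =
  sum_n_m (fun k => (RtoC (eigvec n k) * eigchain d c (block v N) k)%C) 1 n.
Proof.
  intros Hc Hn.
  transitivity (boxsum (S d) N (fun a => sum_n_m (fun k => RtoC (eigvec n k) *
    (RtoC (eigcoord (lhs_index d c a) k) *
     Cprod (map (fun i => v i (nth i a 0%nat)) (seq 0 (S d))))) 1 n)%C).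
  - apply boxsum_ext. intros a.
    rewrite tstar_trunc_eigcoord, RtoC_sum_n_m by (exact Hn || apply lhs_index_ge1, Hc).
    rewrite <- Csum_n_m_mult_r. apply Csum_n_m_ext_loc. intros k _. rewrite RtoC_mult. ring.
  - rewrite (boxsum_sum_n_m (S d) N 1 n (fun k a => (RtoC (eigvec n k) *
      (RtoC (eigcoord (lhs_index d c a) k) *
       Cprod (map (fun i => v i (nth i a 0%nat)) (seq 0 (S d)))))%C)).
    apply Csum_n_m_ext_loc. intros k Hk. rewrite boxsum_mult_l. f_equal. apply boxsum_eigcoord. lia.
Qed.

(** * Summation over the chains [k_0 >= ... >= k_d] *)

Lemma chainsum_ext (n N : nat) (F G : list nat -> C) :
  (forall l, F l = G l) -> chainsum n N F = chainsum n N G.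
Proof.
  revert N F G. induction n as [|n IH]; intros N F G H; cbn [chainsum]; [apply H|].
  apply Csum_n_m_ext_loc. intros a _. apply IH. intros l. apply H.
Qed.

Lemma chainsum_mult_l (n N : nat) (x : C) (F : list nat -> C) :
  chainsum n N (fun l => (x * F l)%C) = (x * chainsum n N F)%C.
Proof.
  revert N F. induction n as [|n IH]; intros N F; cbn [chainsum]; [reflexivity|].
  rewrite <- Csum_n_m_mult_l. apply Csum_n_m_ext_loc. intros a _. apply (IH a (fun l => F (a :: l))).
Qed.

Lemma chainsum_S (n N : nat) (F : list nat -> C) :
  chainsum (S n) N F = sum_n_m (fun k => chainsum n k (fun l => F (k :: l))) 1 N.
Proof. reflexivity. Qed.

Lemma Vsharp_Wsum (s : list nat) (k m : nat) : (m <= k)%nat ->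
  Vsharp s k m = odd_r k / odd_r m * Wsum s k m.
Proof.
  intros H. destruct s as [|a s]; cbn [Vsharp].
  - cbn [Wsum]. destruct (Nat.eq_dec k m) as [->|Hkm].
    + rewrite tri_refl. simpl. field. apply odd_r_neq0.
    + rewrite tri_neq by exact Hkm. simpl. field. apply odd_r_neq0.
  - apply Nat.leb_le in H. now rewrite H.
Qed.

Definition delta_factor (c k : nat) : R := (-1) ^ (k * delta c) * odd_r k ^ delta c.

Definition link (c k m : nat) : R := delta_factor c m / odd_r m * Vsharp (ones c) k m.

Lemma eigmat_link (c k m : nat) : (1 <= c)%nat -> c <> 2%nat -> (m <= k)%nat ->
  eigmat c k m = delta_factor c k / odd_r k ^ 2 * link c k m.
Proof.
  intros Hc Hc2 Hmk. pose proof (odd_r_neq0 k). pose proof (odd_r_neq0 m).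
  unfold link. rewrite Vsharp_Wsum by exact Hmk. destruct (Nat.eq_dec c 1) as [->|Hc1].
  - unfold delta_factor. simpl delta. cbn [eigmat ones repeat Nat.sub Wsum].
    rewrite !Nat.mul_1_r, !pow_1, pow_add. field. split; assumption.
  - rewrite eigmat_ge3 by lia. unfold delta_factor.
    replace (delta c) with 0%nat by (destruct c as [|[|c]]; [lia|lia|reflexivity]).
    rewrite !Nat.mul_0_r, !pow_O. field. split; assumption.
Qed.

(* The head index [p] of [p :: ks] plays the role of [k_(-1)], so that a chain can be cut after its
   first element. *)
Definition chain_factor (c : nat -> nat) (y : nat -> nat -> C) (p : nat) (ks : list nat) (i : nat) : C :=
  let ki := nth i ks 0%nat in
  (RtoC (link (c i) (nth i (p :: ks) 0%nat) ki * delta_factor (c (S i)) ki) * y i ki)%C.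

Lemma chainsum_chain_factor (d N p : nat) (c : nat -> nat) (y : nat -> nat -> C) :
  c (S d) = 0%nat -> (forall i, (1 <= i <= d)%nat -> (1 <= c i)%nat /\ c i <> 2%nat) ->
  chainsum (S d) N (fun ks => Cprod (map (chain_factor c y p ks) (seq 0 (S d)))) =
  sum_n_m (fun k => (RtoC (link (c 0%nat) p k) *
    eigchain d c (fun i m => RtoC (odd_r m ^ 2) * y i m) k)%C) 1 N.
Proof.
  revert c y N p. induction d as [|d IH]; intros c y N p Hlast Hc; rewrite chainsum_S;
    apply Csum_n_m_ext_loc; intros k Hk.
  - cbn [chainsum eigchain seq map]. unfold Cprod, fold_right, chain_factor, delta_factor.
    rewrite Hlast. cbn [nth delta].
    rewrite (Nat.mul_comm k 2), pow_1_even, !RtoC_mult. ring.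
  - transitivity (chainsum (S d) k (fun l => (RtoC (link (c 0%nat) p k * delta_factor (c 1%nat) k) *
      y 0%nat k *
      Cprod (map (chain_factor (fun i => c (S i)) (fun i => y (S i)) k l) (seq 0 (S d))))%C)).
    { apply chainsum_ext. intros l. rewrite (Cprod_seq_S _ (S d)). reflexivity. }
    rewrite chainsum_mult_l, (IH (fun i => c (S i)) (fun i => y (S i)) k k)
      by (exact Hlast || (intros; apply Hc; lia)).
    cbn [eigchain].
    rewrite (Csum_n_m_ext_loc (fun m => RtoC (eigmat (c 1%nat) k m) * _)%C
      (fun m => (RtoC (delta_factor (c 1%nat) k / odd_r k ^ 2) * (RtoC (link (c 1%nat) k m) *
         eigchain d (fun i => c (S i)) (fun i m => RtoC (odd_r m ^ 2) * y (S i) m) m))%C)).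
    + rewrite Csum_n_m_mult_l. set (tail := sum_n_m _ _ _).
      replace (RtoC (link (c 0%nat) p k * delta_factor (c 1%nat) k)) with
        (RtoC (link (c 0%nat) p k) *
         (RtoC (odd_r k ^ 2) * RtoC (delta_factor (c 1%nat) k / odd_r k ^ 2)))%C.
      * ring.
      * rewrite <- !RtoC_mult. f_equal. field. apply odd_r_neq0.
    + intros m Hm. rewrite eigmat_link, RtoC_mult; [ring|apply Hc; lia|apply Hc; lia|lia].
Qed.

Lemma powerRZ_pred (x : R) (n : nat) : x <> 0 -> powerRZ x (Z.of_nat n - 1) = x ^ n / x.
Proof.
  intros Hx. unfold Z.sub. rewrite powerRZ_add, <- pow_powerRZ by exact Hx.
  simpl. now rewrite Rmult_1_r.
Qed.

Lemma rhs_factor_chain_factor (d : nat) (c : nat -> nat) (z : nat -> C) (ks : list nat) (i : nat) :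
  rhs_factor d c z ks i =
  chain_factor (cext d c) (fun i k => / (RtoC (odd_r k ^ 2) - z i * z i))%C 0 ks i.
Proof.
  unfold rhs_factor, chain_factor, link, delta_factor, Cdiv. cbv zeta.
  rewrite powerRZ_pred by apply odd_r_neq0. rewrite Nat.mul_add_distr_l, !pow_add.
  destruct i as [|i]; cbn [nth]; f_equal; f_equal; field; apply odd_r_neq0.
Qed.

(** * The geometric series in each block [{2}^a] *)

Lemma Csum_pow (q : C) (p n : nat) : (p <= S n)%nat ->
  ((1 - q) * sum_n_m (fun a => q ^ a) p n)%C = (q ^ p - q ^ S n)%C.
Proof.
  induction n as [|n IH]; intros Hp.
  - destruct p as [|[|p]]; [rewrite sum_n_n; simpl; ring| |lia].
    rewrite sum_n_m_zero by lia. change zero with (RtoC 0). ring.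
  - destruct (Nat.eq_dec p (S (S n))) as [->|Hne].
    + rewrite sum_n_m_zero by lia. change zero with (RtoC 0). ring.
    + rewrite sum_n_Sm by lia. change plus with Cplus.
      rewrite Cmult_plus_distr_l, IH, !Cpow_S by lia. ring.
Qed.

Lemma one_minus_neq0 (q : C) : Cmod q < 1 -> (1 - q)%C <> RtoC 0.
Proof.
  intros Hq E. replace q with (RtoC 1) in Hq; [rewrite Cmod_1 in Hq; lra|].
  replace q with (1 - (1 - q))%C by ring. rewrite E. ring.
Qed.

Lemma Cmod_sum_pow_le (q : C) (r : R) (p n : nat) : (p <= S n)%nat -> Cmod q <= r -> r < 1 ->
  Cmod (sum_n_m (fun a => q ^ a)%C p n) <= Cmod q ^ p * (2 / (1 - r)).
Proof.
  intros Hp Hq Hr. pose proof (Cmod_ge_0 q) as Hq0.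
  pose proof (f_equal Cmod (Csum_pow q p n Hp)) as E. rewrite Cmod_mult in E.
  set (s := sum_n_m _ _ _) in *.
  assert (Hden : 1 - r <= Cmod (1 - q)).
  { pose proof (Cmod_triangle (1 - q) q) as Ht.
    replace (1 - q + q)%C with (RtoC 1) in Ht by ring. rewrite Cmod_1 in Ht. lra. }
  assert (Hnum : Cmod (q ^ p - q ^ S n) <= 2 * Cmod q ^ p).
  { unfold Cminus. apply Rle_trans with (1 := Cmod_triangle _ _). rewrite Cmod_opp, !Cmod_pow.
    replace (S n) with (p + (S n - p))%nat by lia. rewrite pow_add.
    assert (Cmod q ^ (S n - p) <= 1) by (rewrite <- (pow1 (S n - p)); apply pow_incr; lra).
    pose proof (pow_le (Cmod q) p Hq0). nra. }
  replace (Cmod q ^ p * (2 / (1 - r))) with (2 * Cmod q ^ p / (1 - r)) by (unfold Rdiv; ring).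
  apply Rle_div_r; [lra|]. rewrite Rmult_comm. apply Rle_trans with (2 := Hnum). rewrite <- E.
  apply Rmult_le_compat_r; [apply Cmod_ge_0|exact Hden].
Qed.

Lemma filterlim_sum_pow (q : C) (p : nat) : Cmod q < 1 ->
  filterlim (sum_n_m (fun a => q ^ a)%C p) eventually (locally (q ^ p / (1 - q))%C).
Proof.
  intros Hq. pose proof (one_minus_neq0 q Hq) as Hne.
  apply filterlim_ext_loc with (fun n => (q ^ p + - q * q ^ n) * / (1 - q))%C.
  { exists p. intros n Hn. transitivity ((1 - q) * sum_n_m (fun a => q ^ a) p n * / (1 - q))%C.
    - rewrite Csum_pow, Cpow_S by lia. f_equal. ring.
    - field. exact Hne. }
  replace (q ^ p / (1 - q))%C with ((q ^ p + - q * 0) * / (1 - q))%C by (unfold Cdiv; ring).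
  apply filterlim_Cmult; [|apply filterlim_const].
  apply (filterlim_comp_2 (G := locally (q ^ p)%C) (H := locally (- q * 0)%C)).
  - apply filterlim_const.
  - apply filterlim_Cmult; [apply filterlim_const|apply filterlim_Cpow_zero, Hq].
  - exact (filterlim_plus (V := C_NormedModule) (q ^ p)%C (- q * 0)%C).
Qed.

Lemma finite_sup_lt (n : nat) (x : nat -> R) (b : R) :
  (forall j, (j <= n)%nat -> x j < b) -> exists r, r < b /\ forall j, (j <= n)%nat -> x j <= r.
Proof.
  induction n as [|n IH]; intros Hx.
  - exists (x 0%nat). split; [apply Hx; lia|]. intros j Hj. replace j with 0%nat by lia. lra.
  - destruct IH as [r [Hr H]]; [intros; apply Hx; lia|].
    exists (Rmax r (x (S n))). split.
    + apply Rmax_lub_lt; [exact Hr|apply Hx; lia].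
    + intros j Hj. destruct (Nat.eq_dec j (S n)) as [->|Hne]; [apply Rmax_r|].
      apply Rle_trans with (2 := Rmax_l _ _). apply H. lia.
Qed.

(** * The generating function *)

Section Blocks.

Variables (u : nat) (z : nat -> C).

(* The condition a_u >= 1 makes the geometric series of block u start at 1. *)
Definition block_start (i : nat) : nat := Nat.b2n (Nat.eqb i u).

Definition block_ratio (i k : nat) : C := (z i * z i * RtoC (/ odd_r k ^ 2))%C.

Definition block_weight (i a : nat) : C :=
  if Nat.ltb a (block_start i) then RtoC 0 else (z i ^ (2 * a))%C.

Definition block_lim (i k : nat) : C := (block_ratio i k ^ block_start i / (1 - block_ratio i k))%C.

Lemma block_start_le1 (i : nat) : (block_start i <= 1)%nat.
Proof. unfold block_start. destruct (Nat.eqb i u); simpl; lia. Qed.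

Lemma block_start_refl : block_start u = 1%nat.
Proof. unfold block_start. now rewrite Nat.eqb_refl. Qed.

Lemma block_geometric (N i k : nat) :
  block block_weight N i k = sum_n_m (fun a => block_ratio i k ^ a)%C (block_start i) N.
Proof.
  assert (Hterm : forall a, (z i ^ (2 * a) * RtoC ((/ odd_r k ^ 2) ^ a))%C = (block_ratio i k ^ a)%C).
  { intros a. unfold block_ratio. rewrite RtoC_pow, Cpow_mult_l, Cpow_mult_r. f_equal. f_equal.
    simpl. ring. }
  unfold block, block_weight, block_start. destruct (Nat.eqb i u); cbn [Nat.b2n].
  - rewrite sum_Sn_m by lia. cbn [Nat.ltb Nat.leb]. rewrite Cmult_0_l.
    etransitivity; [apply (plus_zero_l (G := C_AbelianMonoid))|].
    apply Csum_n_m_ext_loc. intros [|a] Ha; [lia|]. apply Hterm.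
  - apply Csum_n_m_ext_loc. intros a _. apply Hterm.
Qed.

Lemma Cmod_block_ratio_le (i k : nat) : Cmod (z i) <= 1 -> (1 <= k)%nat ->
  Cmod (block_ratio i k) <= Cmod (z i) /\ Cmod (block_ratio i k) <= / INR k ^ 2.
Proof.
  intros Hz Hk. pose proof (Cmod_ge_0 (z i)). pose proof (inv_odd_r_pow_nonneg k 2 Hk).
  pose proof (one_le_INR k Hk). pose proof (INR_le_odd_r k Hk).
  assert (/ odd_r k ^ 2 <= / INR k ^ 2) by (apply Rinv_le_contravar; [apply pow_lt|apply pow_incr]; lra).
  assert (/ odd_r k ^ 2 <= 1) by (rewrite <- Rinv_1, <- (pow_O (odd_r k)); apply inv_odd_r_pow_le; lia).
  unfold block_ratio. rewrite !Cmod_mult, Cmod_R, Rabs_pos_eq by assumption.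
  assert (0 <= Cmod (z i) * Cmod (z i) <= Cmod (z i)) by nra. split; nra.
Qed.

Lemma Cmod_block_le (N i k : nat) (r : R) : Cmod (z i) <= r -> r < 1 -> (1 <= k)%nat ->
  Cmod (block block_weight N i k) <= Cmod (block_ratio i k) ^ block_start i * (2 / (1 - r)).
Proof.
  intros Hz Hr Hk. rewrite block_geometric. pose proof (block_start_le1 i).
  destruct (Cmod_block_ratio_le i k) as [Hle _]; [lra|exact Hk|].
  apply Cmod_sum_pow_le; [lia|lra|exact Hr].
Qed.

Lemma Cmod_block_le_geom (N i k : nat) (r : R) : Cmod (z i) <= r -> r < 1 -> (1 <= k)%nat ->
  Cmod (block block_weight N i k) <= 2 / (1 - r).
Proof.
  intros Hz Hr Hk. apply Rle_trans with (1 := Cmod_block_le N i k r Hz Hr Hk).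
  destruct (Cmod_block_ratio_le i k) as [Hle _]; [lra|exact Hk|].
  pose proof (Cmod_ge_0 (block_ratio i k)).
  rewrite <- (Rmult_1_l (2 / (1 - r))) at 2. apply Rmult_le_compat_r.
  - apply Rlt_le, Rdiv_lt_0_compat; lra.
  - rewrite <- (pow1 (block_start i)). apply pow_incr. lra.
Qed.

Lemma Cmod_block_u_le (N k : nat) (r : R) : Cmod (z u) <= r -> r < 1 -> (1 <= k)%nat ->
  Cmod (block block_weight N u k) <= 2 / (1 - r) / INR k ^ 2.
Proof.
  intros Hz Hr Hk. apply Rle_trans with (1 := Cmod_block_le N u k r Hz Hr Hk).
  destruct (Cmod_block_ratio_le u k) as [_ Hle]; [lra|exact Hk|].
  rewrite block_start_refl, pow_1, Rmult_comm. apply Rmult_le_compat_l; [|exact Hle].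
  apply Rlt_le, Rdiv_lt_0_compat; lra.
Qed.

Lemma filterlim_block (i k : nat) : Cmod (z i) < 1 -> (1 <= k)%nat ->
  filterlim (fun N => block block_weight N i k) eventually (locally (block_lim i k)).
Proof.
  intros Hz Hk. apply filterlim_ext with (sum_n_m (fun a => block_ratio i k ^ a)%C (block_start i)).
  { intros N. symmetry. apply block_geometric. }
  apply filterlim_sum_pow.
  destruct (Cmod_block_ratio_le i k); [lra|exact Hk|lra].
Qed.

Lemma block_lim_denominator (i k : nat) : Cmod (z i) < 1 -> (1 <= k)%nat ->
  (RtoC (odd_r k ^ 2) * (block_ratio i k ^ block_start i * / (RtoC (odd_r k ^ 2) - z i * z i)))%C =
  block_lim i k.
Proof.
  intros Hz Hk. unfold block_lim.
  assert (Hne : (1 - block_ratio i k)%C <> RtoC 0).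
  { apply one_minus_neq0. destruct (Cmod_block_ratio_le i k); [lra|exact Hk|lra]. }
  assert (Hodd : RtoC (odd_r k ^ 2) <> RtoC 0).
  { intros E. apply (odd_r_pow_neq0 k 2), RtoC_inj, E. }
  replace (RtoC (odd_r k ^ 2) - z i * z i)%C with (RtoC (odd_r k ^ 2) * (1 - block_ratio i k))%C.
  - field. split; assumption.
  - unfold block_ratio. rewrite RtoC_inv by apply odd_r_pow_neq0. field. exact Hodd.
Qed.

Lemma Cprod_block_weight (d : nat) (a : list nat) : (u <= d)%nat ->
  Cprod (map (fun i => block_weight i (nth i a 0%nat)) (seq 0 (S d))) =
  if Nat.eqb (nth u a 0%nat) 0 then RtoC 0
  else Cprod (map (fun i => z i ^ (2 * nth i a 0%nat))%C (seq 0 (S d))).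
Proof.
  intros Hu. transitivity ((if Nat.eqb (nth u a 0%nat) 0 then RtoC 0 else RtoC 1) *
    Cprod (map (fun i => z i ^ (2 * nth i a 0%nat))%C (seq 0 (S d))))%C.
  - rewrite <- (Cprod_seq_mult_at _ _ u) by lia. f_equal. apply map_ext. intros i.
    unfold block_weight, block_start. destruct (Nat.eqb_spec i u) as [->|]; cbn [Nat.b2n].
    + destruct (nth u a 0%nat); cbn [Nat.ltb Nat.leb Nat.eqb]; ring.
    + cbn [Nat.ltb Nat.leb]. ring.
  - destruct (Nat.eqb (nth u a 0%nat) 0); ring.
Qed.

End Blocks.

Lemma lhs_trunc_block_weight (d u : nat) (c : nat -> nat) (z : nat -> C) (N : nat) : (u <= d)%nat ->
  lhs_trunc d u c z N = boxsum (S d) N (fun a => (RtoC (tstar (lhs_index d c a)) *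
    Cprod (map (fun i => block_weight u z i (nth i a 0%nat)) (seq 0 (S d))))%C).
Proof.
  intros Hu. apply boxsum_ext. intros a. rewrite Cprod_block_weight by exact Hu.
  destruct (Nat.eqb (nth u a 0%nat) 0); [ring|reflexivity].
Qed.

Lemma filterlim_lhs_trunc (d u : nat) (c : nat -> nat) (z : nat -> C) (N : nat) :
  (u <= d)%nat -> (forall i, (1 <= i <= d)%nat -> (1 <= c i)%nat) ->
  ((1 <= u)%nat -> (2 <= c 1)%nat) ->
  filterlim (fun n => sum_n_m (fun k =>
      (RtoC (eigvec n k) * eigchain d c (block (block_weight u z) N) k)%C) 1 n)
    eventually (locally (lhs_trunc d u c z N)).
Proof.
  intros Hu Hc Hc1. rewrite lhs_trunc_block_weight by exact Hu.
  apply filterlim_ext_loc with (fun n => boxsum (S d) N (fun a =>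
    (RtoC (tstar_trunc (lhs_index d c a) n) *
     Cprod (map (fun i => block_weight u z i (nth i a 0%nat)) (seq 0 (S d))))%C)).
  { exists 1%nat. intros n Hn. now apply boxsum_tstar_trunc. }
  apply filterlim_boxsum. intros a. rewrite Cprod_block_weight by exact Hu.
  destruct (Nat.eqb_spec (nth u a 0%nat) 0) as [E|E].
  - rewrite Cmult_0_r. apply filterlim_ext with (fun _ => RtoC 0); [intros; ring|apply filterlim_const].
  - apply filterlim_Cmult; [|apply filterlim_const]. apply filterlim_RtoC_comp, is_lim_seq_tstar.
    + now apply lhs_index_ge1.
    + now apply hd_lhs_index_ge2 with u.
Qed.

Lemma eigchain_block_decay (d u : nat) (c : nat -> nat) (z : nat -> C) :
  (u <= d)%nat -> (forall i, (1 <= i <= d)%nat -> (1 <= c i)%nat) ->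
  ((1 <= u)%nat -> (2 <= c 1)%nat) -> (forall j, (j <= d)%nat -> Cmod (z j) < 1) ->
  exists A, forall N k, (1 <= k)%nat ->
    Cmod (eigchain d c (block (block_weight u z) N) k) <= A / sqrt (INR k).
Proof.
  intros Hu Hc Hc1 Hz. destruct (finite_sup_lt d (fun j => Cmod (z j)) 1 Hz) as [r [Hr Hzr]].
  destruct (eigchain_decay d u c (2 / (1 - r)) Hu Hc Hc1) as [A H].
  { apply Rlt_le, Rdiv_lt_0_compat; lra. }
  exists A. intros N. apply H.
  - intros i m Hi Hm. apply Cmod_block_le_geom; [apply Hzr, Hi|exact Hr|exact Hm].
  - intros m Hm. apply Cmod_block_u_le; [apply Hzr, Hu|exact Hr|exact Hm].
Qed.

Lemma link_cext_0 (d : nat) (c : nat -> nat) (k : nat) : (1 <= k)%nat ->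
  2 / PI * link (cext d c 0) 0 k = eigvec_lim k.
Proof.
  intros Hk. unfold eigvec_lim, link, delta_factor. cbn [cext Nat.eqb delta ones repeat Nat.sub Vsharp].
  rewrite tri_neq, Nat.mul_1_r, !pow_1 by lia.
  replace (odd_r 0) with (-1) by (unfold odd_r; simpl; ring). simpl pow. field.
  split; [apply odd_r_neq0|apply PI_neq0].
Qed.

Lemma rhs_trunc_eigchain (d u : nat) (c : nat -> nat) (z : nat -> C) (N : nat) :
  (u <= d)%nat -> (forall i, (1 <= i <= d)%nat -> (1 <= c i)%nat /\ c i <> 2%nat) ->
  (forall j, (j <= d)%nat -> Cmod (z j) < 1) ->
  rhs_trunc d u c z N = sum_n_m (fun k => (RtoC (eigvec_lim k) * eigchain d c (block_lim u z) k)%C) 1 N.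
Proof.
  intros Hu Hc Hz. unfold rhs_trunc.
  set (y := fun i k => (block_ratio z i k ^ block_start u i * / (RtoC (odd_r k ^ 2) - z i * z i))%C).
  transitivity (RtoC (2 / PI) * chainsum (S d) N (fun ks =>
    Cprod (map (chain_factor (cext d c) y 0 ks) (seq 0 (S d)))))%C.
  - rewrite <- !chainsum_mult_l. apply chainsum_ext. intros ks.
    transitivity (RtoC (2 / PI) * (block_ratio z u (nth u ks 0%nat) *
      Cprod (map (rhs_factor d c z ks) (seq 0 (S d)))))%C; [unfold block_ratio; ring|].
    f_equal. rewrite <- (Cprod_seq_mult_at _ _ u) by lia. f_equal. apply map_ext. intros i.
    rewrite rhs_factor_chain_factor. unfold chain_factor, y, block_start.
    destruct (Nat.eqb_spec i u) as [->|]; simpl; ring.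
  - rewrite chainsum_chain_factor, <- Csum_n_m_mult_l.
    + apply Csum_n_m_ext_loc. intros k Hk. rewrite Cmult_assoc, <- RtoC_mult, link_cext_0 by lia.
      f_equal. apply eigchain_ext; [| |lia].
      * intros i Hi. unfold cext. destruct (Nat.eqb_spec i 0), (Nat.eqb_spec i (S d)); lia.
      * intros i m Hi Hm. apply block_lim_denominator; [apply Hz, Hi|exact Hm].
    + unfold cext. simpl. now rewrite Nat.eqb_refl.
    + intros i Hi. unfold cext.
      destruct (Nat.eqb_spec i 0), (Nat.eqb_spec i (S d)); try lia. now apply Hc.
Qed.

(** * Passage to the limit *)

Lemma is_series_decay_dominated (b : nat -> nat -> R) (b' : nat -> R) (t : nat -> nat -> C)
  (t' : nat -> C) (A : R) (s : nat -> C) :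
  (forall n k, (1 <= k)%nat -> Rabs (b n k) <= 2 / INR k) ->
  (forall n k, (1 <= k)%nat -> Cmod (t n k) <= A / sqrt (INR k)) ->
  (forall k, is_lim_seq (fun n => b n k) (b' k)) ->
  (forall k, (1 <= k)%nat -> filterlim (fun n => t n k) eventually (locally (t' k))) ->
  (forall n, is_series (fun k => (RtoC (b n (S k)) * t n (S k))%C) (s n)) ->
  exists l : C, is_series (fun k => (RtoC (b' (S k)) * t' (S k))%C) l /\
    filterlim s eventually (locally l).
Proof.
  intros Hb Ht Hb' Ht' Hs.
  apply (is_series_dominated (V := C_CompleteNormedModule)
    (fun n k => (RtoC (b n (S k)) * t n (S k))%C) _ s
    (fun k => scal (2 * A) (/ (INR (S k) * sqrt (INR (S k)))))).
  - intros n k. change (Cmod (RtoC (b n (S k)) * t n (S k)) <=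
      2 * A * / (INR (S k) * sqrt (INR (S k)))).
    rewrite Cmod_mult, Cmod_R, Rinv_mult.
    replace (2 * A * (/ INR (S k) * / sqrt (INR (S k)))) with (2 / INR (S k) * (A / sqrt (INR (S k))))
      by (unfold Rdiv; ring).
    apply Rmult_le_compat; [apply Rabs_pos|apply Cmod_ge_0|apply Hb; lia|apply Ht; lia].
  - apply (ex_series_scal (V := R_NormedModule)), ex_series_inv_mul_sqrt.
  - intros k. apply filterlim_Cmult; [|apply Ht'; lia].
    apply filterlim_RtoC_comp, Hb'.
  - exact Hs.
Qed.

Lemma is_series_eigvec_lim (t : nat -> C) (A : R) (l : C) :
  (forall k, (1 <= k)%nat -> Cmod (t k) <= A / sqrt (INR k)) ->
  filterlim (fun n => sum_n_m (fun k => (RtoC (eigvec n k) * t k)%C) 1 n) eventually (locally l) ->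
  is_series (fun k => (RtoC (eigvec_lim (S k)) * t (S k))%C) l.
Proof.
  intros Ht Hl.
  destruct (is_series_decay_dominated eigvec eigvec_lim (fun _ => t) t A
    (fun n => sum_n_m (fun k => (RtoC (eigvec n k) * t k)%C) 1 n)) as [l' [Hs Hl']].
  - intros n k. apply Rabs_eigvec_le.
  - intros _. exact Ht.
  - apply is_lim_seq_eigvec.
  - intros k _. apply filterlim_const.
  - intros n. apply (is_series_trailing_zeros (V := C_NormedModule)
      (fun k => (RtoC (eigvec n k) * t k)%C)).
    intros k Hk. rewrite eigvec_gt by exact Hk. apply Cmult_0_l.
  - now rewrite (filterlim_locally_unique (V := C_NormedModule) _ _ _ Hl Hl').
Qed.

Theorem theorem3p4 (d u : nat) (c : nat -> nat) (z : nat -> C)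
  (Hud : (u <= d)%nat)
  (Hc : forall i, (1 <= i <= d)%nat -> (1 <= c i)%nat /\ c i <> 2%nat)
  (Hc1 : (1 <= u)%nat -> (3 <= c 1%nat)%nat)
  (Hz : forall j, (j <= d)%nat -> Cmod (z j) < 1) :
  exists L : C,
    filterlim (lhs_trunc d u c z) eventually (locally L) /\
    filterlim (rhs_trunc d u c z) eventually (locally L).
Proof.
  assert (Hc_ge1 : forall i, (1 <= i <= d)%nat -> (1 <= c i)%nat) by (intros; now apply Hc).
  assert (Hc1_ge2 : (1 <= u)%nat -> (2 <= c 1)%nat) by (intros Hu; specialize (Hc1 Hu); lia).
  destruct (eigchain_block_decay d u c z Hud Hc_ge1 Hc1_ge2 Hz) as [A HA].
  destruct (is_series_decay_dominated (fun _ => eigvec_lim) eigvec_lim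
    (fun N => eigchain d c (block (block_weight u z) N)) (eigchain d c (block_lim u z)) A
    (lhs_trunc d u c z)) as [L [Hseries HL]].
  - intros _ k. apply Rabs_eigvec_lim_le.
  - exact HA.
  - intros k. apply is_lim_seq_const.
  - intros k Hk. apply filterlim_eigchain; [|exact Hk].
    intros i m Hi Hm. apply filterlim_block; [apply Hz, Hi|exact Hm].
  - intros N. apply is_series_eigvec_lim with A; [apply HA|].
    now apply filterlim_lhs_trunc.
  - exists L. split; [exact HL|].
    apply filterlim_ext with (2 := is_series_shift
      (fun k => (RtoC (eigvec_lim k) * eigchain d c (block_lim u z) k)%C) L Hseries).
    intros N. symmetry. now apply rhs_trunc_eigchain.
Qed.
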